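(* Let $0<a<b<2\pi$ and let $N\ge0$ be an integer. The angle $\theta(N)$ determined by the ideal digital filter $L_{[a,b]}$ and the space $\mathbf{DF}_N$, and the distance $d(L_{[a,b]},\mathbf{DF}_N)$, are given by $$\theta(N)=\arcsin\left\{\frac12-\frac{b-a}{4\pi}-\sum_{k=1}^{N}\frac{1-\cos(k(b-a))}{k^2\pi(b-a)}\right\}^{1/2},$$ $$d(L_{[a,b]},\mathbf{DF}_N)=\sqrt{\frac{b-a}{2\pi}}\left\{\frac12-\frac{b-a}{4\pi}-\sum_{k=1}^{N}\frac{1-\cos(k(b-a))}{k^2\pi(b-a)}\right\}^{1/2}.$$ In particular, they are both functions of the length of the bandpass interval $[a,b]$. Moreover, they satisfy the following properties: (a) $0<\theta(N)<\pi/4$, $\lim_{(b-a)\to0}\theta(N)=\pi/4$, $\lim_{(b-a)\to2\pi}\theta(N)=0$; (b) $\lim_{(b-a)\to0}d(L_{[a,b]},\mathbf{DF}_N)=\lim_{(b-a)\to2\pi}d(L_{[a,b]},\mathbf{DF}_N)=0$; (c) given the bandpass interval $[a,b]\subset(0,2\pi)$, the sequence $\{\theta(N)\}_{N=0}^{\infty}$ is strictly decreasing and $\lim_{N\to\infty}\theta(N)=0$.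
   Context: Signals are complex valued. $\mathbf{F_d}$ is the normed space (with the operator norm) of digital filters, i.e. bounded linear operators $L:\ell^2(\mathbb{Z})\to\ell^\infty(\mathbb{Z})$ commuting with all integer shifts. Every $L\in\mathbf{F_d}$ is of the form $L=L_h$ for a unique $h\in\ell^2(\mathbb{Z})$, where $L_h(x)=x*h$ is discrete convolution; moreover $\|L_h\|=\|h\|_{\ell^2}$, and $\mathbf{F_d}$ is a Hilbert space with $\langle L_h,L_g\rangle=\langle h,g\rangle_{\ell^2}$. The discrete Fourier transform is $\mathcal{F}_d(\{x[n]\}_{n\in\mathbb{Z}})(w)=\sum_{n=-\infty}^{\infty}x[n]e^{-iwn}$, which satisfies $\|\mathcal{F}_d(x)\|_{L^2(0,2\pi)}^2=2\pi\|x\|_{\ell^2}^2$. The transfer function of $L_h$ is $H=\mathcal{F}_d(h)$ ($2\pi$-periodic). $\mathbf{DF}_N$ (the physically realizable filters with delay time $N$) is the set of all $L_h$, $h\in\ell^2(\mathbb{Z})$, with $h[n]=0$ for all $n<-N$; for $N=0$ these are the causal filters. For $0<a<b<2\pi$, the ideal filter $L_{[a,b]}$ is the digital filter $L_{h_{[a,b]}}$ whose transfer function is $\mathcal{F}_d(h_{[a,b]})=\chi_{[a,b]}$ on $(0,2\pi)$ (the indicator function of $[a,b]$). The distance is $d(L,M)=\inf_{K\in M}\|L-K\|$, and the angle determined by a nonzero filter $L$ and a closed subspace $M$ is $\arcsin\big(d(L,M)/\|L\|\big)\in[0,\pi/2]$. Limits as $(b-a)\to0$ or $(b-a)\to2\pi$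 are, for fixed $N$, over intervals with $0<a<b<2\pi$ whose length tends to $0$ or to $2\pi$. An empty sum is $0$.
   Formalization: In (c), ''strictly decreasing'' fails, e.g. θ(2)=θ(1) when b-a=π; it is replaced by: θ(N) is non-increasing, θ(N+1)<θ(N) iff (N+1)(b-a) is not a multiple of 2π, hence strictly decreasing when (b-a)/(2π) is irrational. *)

(* Defs.v *)
From HB Require Import structures.
From mathcomp Require Import all_boot all_order all_algebra.
From mathcomp Require Import complex ring lra.
From mathcomp Require Import all_classical all_reals all_analysis.

Set Implicit Arguments.
Unset Strict Implicit.
Unset Printing Implicit Defensive.

Import Order.TTheory GRing.Theory Num.Theory.
Import numFieldNormedType.Exports.
Import ComplexField.Normc.

Local Open Scope classical_set_scope.
Local Open Scope ring_scope.
Local Open Scope complex_scope.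

Notation signal R := (int -> R[i]).

Section L2.
Variable R : realType.

Definition energy (x : signal R) : \bar R :=
  \esum_(n in [set: int]) (normc (x n) ^+ 2)%:E.

Definition square_summable : {pred signal R} :=
  fun x => `[< (energy x < +oo)%E >].

Lemma square_summable_submod : submod_closed square_summable.
Proof.
have eE (x : signal R) : (x \in square_summable) = `[< (energy x < +oo)%E >].
  by [].
split.
  rewrite eE; apply/asboolP; rewrite /energy esum1 ?ltry // => n _.
  by rewrite normc0 expr0n.
move=> a u v; rewrite !eE => /asboolP hu /asboolP hv; apply/asboolP.
have sq0 (c : R) (z : R[i]) : 0 <= c -> (0 <= (c * normc z ^+ 2)%:E)%E.
  by move=> c0; rewrite lee_fin mulr_ge0 ?sqr_ge0.
have scale (c : R) (x : signal R) : 0 <= c -> (energy x < +oo)%E ->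
    (\esum_(n in [set: int]) (c * normc (x n) ^+ 2)%:E < +oo)%E.
  move=> c0 hx; apply: (@le_lt_trans _ _ (c%:E * energy x)%E); last first.
    have e0 : (0 <= energy x)%E.
      by apply: esum_ge0 => n _; rewrite lee_fin sqr_ge0.
    have /fineK <- : energy x \is a fin_num by rewrite ge0_fin_numE.
    by rewrite -EFinM ltry.
  apply: ub_ereal_sup => _ [A [fA AT]] <-.
  rewrite (eq_fsbigr (fun n => (c%:E * (normc (x n) ^+ 2)%:E)%E)); last first.
    by move=> n _; rewrite EFinM.
  rewrite -ge0_mule_fsumr; last by move=> n; rewrite lee_fin sqr_ge0.
  apply: lee_wpmul2l; first by rewrite lee_fin.
  by apply: esum_ge; exists A.
apply: (@le_lt_trans _ _ (\esum_(n in [set: int])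
    ((2 * normc a ^+ 2 * normc (u n) ^+ 2)%:E +
     (2 * normc (v n) ^+ 2)%:E))%E).
  apply: le_esum => n _; rewrite -EFinD lee_fin.
  have nn (z : R[i]) : 0 <= normc z by case: z => x y; exact: sqrtr_ge0.
  have tri : normc ((a *: u + v) n) <= normc a * normc (u n) + normc (v n).
    by rewrite -normcM; exact: le_normcD.
  have := nn a; have := nn (u n); have := nn (v n).
  move: tri (nn ((a *: u + v) n)).
  move: (normc a) (normc (u n)) (normc (v n)) (normc _) => p q r t tri t0 r0 q0 p0.
  have : t ^+ 2 <= (p * q + r) ^+ 2.
    by rewrite ler_sqr ?nnegrE ?addr_ge0 ?mulr_ge0.
  have := sqr_ge0 (p * q - r).
  by move=> h1 h2; apply: (le_trans h2); rewrite -subr_ge0; apply: (le_trans h1);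
    rewrite le_eqVlt; apply/orP; left; apply/eqP; ring.
rewrite esumD; last 2 first.
- by move=> n _; rewrite sq0 // mulr_ge0 ?sqr_ge0.
- by move=> n _; rewrite sq0.
by rewrite lte_add_pinfty //; apply: scale => //; rewrite mulr_ge0 ?sqr_ge0.
Qed.

HB.instance Definition _ :=
  GRing.isSubmodClosed.Build R[i] (signal R) square_summable
    square_summable_submod.

Record l2 : Type :=
  L2 {l2val :> signal R; l2valP : l2val \in square_summable}.

HB.instance Definition _ := [isSub for l2val].
HB.instance Definition _ := [Choice of l2 by <:].
HB.instance Definition _ := [SubChoice_isSubLmodule of l2 by <:].

End L2.

Arguments energy {R} x.

Section DigitalFilters.
Variable R : realType.

Definition l2norm (x : l2 R) : R := Num.sqrt (fine (energy x)).

Definition linfnorm (y : signal R) : R := sup [set normc (y n) | n in [set: int]].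

(* [filter_bounded] also says that L takes its values in the space of bounded
   signals; in [filter_shift_invariant], y is the shift of x by k. *)
Record digital_filter (L : l2 R -> signal R) : Prop := DigitalFilter {
  filter_linear : linear L;
  filter_bounded : exists M : R, forall x n, normc (L x n) <= M * l2norm x;
  filter_shift_invariant : forall (k : int) (x y : l2 R),
    (forall n, y n = x (n - k)) -> forall n, L y n = L x (n - k)
}.

Definition opnorm (L : l2 R -> signal R) : R :=
  sup [set linfnorm (L x) | x in [set x : l2 R | l2norm x <= 1]].

Definition dist (L : l2 R -> signal R) (M : set (l2 R -> signal R)) : R :=
  inf [set opnorm (L - K) | K in M].

Definition angle (L : l2 R -> signal R) (M : set (l2 R -> signal R)) : R :=
  asin (dist L M / opnorm L).

(* The sum of f k over - m <= k <= m. *)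
Definition zpartial_sum (f : int -> R[i]) (m : nat) : R[i] :=
  \sum_(k < m.*2.+1) f (k%:Z - m%:Z).

(* The limit is taken on real and imaginary parts. The order of summation does
   not matter for the absolutely convergent series of [conv_filter]. *)
Definition zsum (f : int -> R[i]) : R[i] :=
  limn (fun m => complex.Re (zpartial_sum f m)) +i*
  limn (fun m => complex.Im (zpartial_sum f m)).

Definition conv_filter (h : l2 R) (x : l2 R) : signal R :=
  fun n => zsum (fun k => x k * h (n - k)).

(* exp (- i w n) *)
Definition fourier_mode (w : R) (n : int) : R[i] :=
  cos (n%:~R * w) -i* sin (n%:~R * w).

(* H is the discrete Fourier transform of h, as an element of L^2(0, 2 pi):
   the partial sums of the series of h n * exp (- i w n) converge to H in
   quadratic mean. *)
Definition is_dft (h : l2 R) (H : R -> R[i]) : Prop :=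
  [/\ measurable_fun `]0, 2 * pi[ (fun w => complex.Re (H w)),
      measurable_fun `]0, 2 * pi[ (fun w => complex.Im (H w)) &
      (\int[lebesgue_measure]_(w in `]0%R, (2 * pi)%R[)
         (normc (zpartial_sum (fun n => h n * fourier_mode w n) m - H w)%R
          ^+ 2)%:E)%E @[m --> \oo] --> 0%E].

(* The h with transfer function the indicator of [a, b]; a square-summable
   sequence is determined by its Fourier transform, so the choice is that of
   the unique such h. *)
Definition ideal_response (a b : R) : l2 R :=
  xget 0 [set h | is_dft h (fun w => (\1_(`[a, b] : set R) w)%:C)].

Definition ideal_filter (a b : R) : l2 R -> signal R :=
  conv_filter (ideal_response a b).

Definition DF (N : nat) : set (l2 R -> signal R) :=
  [set L | digital_filter L /\
     exists2 h : l2 R, (forall n : int, n < - N%:Z -> h n = 0) &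
       L = conv_filter h].

Definition theta (a b : R) (N : nat) : R := angle (ideal_filter a b) (DF N).

Definition is_band (a b : R) : Prop := [/\ 0 < a, a < b & b < 2 * pi].

(* The filter on pairs (a, b) for limits as b - a tends to l, over the
   intervals [a, b] included in (0, 2 pi). *)
Definition band_length_nbhs (l : R) : set_system (R * R) :=
  within [set ab | is_band ab.1 ab.2]
    (filter_from (nbhs l) (fun U => [set ab | U (ab.2 - ab.1)])).

End DigitalFilters.

(* Main.v *)
Require Import Defs.
From mathcomp Require Import all_boot all_order all_algebra.
From mathcomp Require Import complex ring lra zify.
From mathcomp Require Import all_classical all_reals all_analysis.
From mathcomp Require Import measurable_realfun.

Set Implicit Arguments.
Unset Strict Implicit.
Unset Printing Implicit Defensive.

Import Order.TTheory GRing.Theory Num.Theory.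
Import numFieldNormedType.Exports.
Import ComplexField.Normc.

Local Open Scope classical_set_scope.
Local Open Scope ring_scope.

(** The operator norm of the filter [x |-> x * h] is the norm of [h]
    ([opnorm_conv_filter]): Cauchy-Schwarz gives one inequality, and the reversed
    conjugate of [h] the other. So filters may be replaced by their impulse
    responses, and [DF N] by the sequences that vanish before [- N]. The nearest
    such sequence to [h] is its truncation, and the distance is the norm of the
    removed part ([dist_DF]).

    The impulse response of the ideal filter consists of the Fourier coefficients
    of the indicator of [[a, b]]. With [t = b - a], the [n]-th one has squared
    modulus [(1 - cos (n * t)) / (2 * pi ^+ 2 * n ^+ 2)], so everything reduces to
    the identity
      [sum_(n >= 1) (1 - cos (n * t)) / n ^+ 2 = pi * t / 2 - t ^+ 2 / 4]
    on (0, 2 pi). It is equivalent to the Parseval identity for the indicator, hence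
    also to the convergence of its Fourier series in quadratic mean, which is what
    makes the explicit coefficients a response with the required transform
    ([is_dft_band_response]).

    Let [cos_gap t m] be the [m]-th partial sum minus the right-hand side. The
    squared error of the [m]-th Fourier partial sum is [- (2 / pi) * cos_gap t m]
    ([band_dft_error]), so [cos_gap t m <= 0]: this is Bessel's inequality. For the
    other direction, consider the sum [U] of the gaps of index below [m]. Its second
    derivative is a Fejer kernel, bounded independently of [m] away from 0, and its
    derivative vanishes at [pi]; so on [[d, pi]] it varies by at most a constant
    that depends on [d] only. At [d] it is at least [- m * pi * d / 2]. Dividing by
    [m], and choosing [d] small before [m] large, one finds that [cos_gap t m] is
    eventually above any negative number ([cos_gap_lower]).

    The energy of the response before [- N] is therefore
    [- cos_gap t N / (2 * pi ^+ 2)], its total energy is [t / (2 * pi)], and the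
    squared sine of the angle is the quotient
    [sin2_angle t N = - cos_gap t N / (pi * t)]. It is positive because two
    consecutive terms of the series cannot both vanish; it is at most
    [1 / 2 - t / (4 * pi)], which gives the bound by [pi / 4] and the limit at
    [2 * pi]; a second-order estimate at 0 gives the limit [1 / 2] there. It
    decreases with [N] by the next term of the series, which vanishes exactly when
    [N.+1 * t] is a multiple of [2 * pi], and it tends to 0 with the gap. *)

(** * The cosine series *)

Lemma pi_neq0 (R : realType) : pi != 0 :> R.
Proof. by rewrite gt_eqF// pi_gt0. Qed.

(** The tactic field computes through the definition of pi as the double of a
    number; abstracting pi beforehand keeps it an atom. *)
Ltac field_pi := match goal with |- @eq ?T _ _ =>
  let p := fresh in let p0 := fresh in
  have p0 := pi_neq0 T; move: (@pi T) p0 => p p0; field; rewrite ?p0 ?nat1r ?pnatr_eq0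
  end.

Section CosineSeries.
Variable R : realType.
Implicit Types (t d : R) (m j n : nat).

Definition cos_sum t m : R :=
  \sum_(k < m) (1 - cos (k.+1%:R * t)) / k.+1%:R ^+ 2.

(** Up to the factor [- 2 / pi], this is the squared L^2 error of the m-th Fourier
    partial sum of the indicator of an interval of length [t]; that it tends to 0
    is the Fourier expansion of [pi * t / 2 - t ^+ 2 / 4]. *)
Definition cos_gap t m : R := cos_sum t m + t ^+ 2 / 4 - pi * t / 2.

Definition cos_gap' t m : R :=
  \sum_(k < m) sin (k.+1%:R * t) / k.+1%:R + (t - pi) / 2.

Definition dirichlet t m : R := 1 / 2 + \sum_(k < m) cos (k.+1%:R * t).

(** Multiplying by [1 - cos t] instead of the usual [sin (t / 2)] makes the
    Dirichlet kernel telescope without half angles. *)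
Lemma dirichletE t m :
  2 * (1 - cos t) * dirichlet t m = cos (m%:R * t) - cos (m.+1%:R * t).
Proof.
rewrite /dirichlet; elim: m => [|m IH].
  by rewrite big_ord0 mul0r cos0 !mul1r; field.
rewrite big_ord_recr /= addrA mulrDr IH.
have -> : m%:R * t = m.+1%:R * t - t by rewrite -natr1; ring.
have -> : m.+2%:R * t = m.+1%:R * t + t by rewrite -(natr1 m.+1); ring.
by rewrite cosB cosD; ring.
Qed.

(** The sums of Dirichlet kernels telescope once more. This is the Fejer kernel,
    whose closed form shows that it is nonnegative and, away from the multiples of
    [2 * pi], bounded independently of [m]. *)
Lemma fejerE t m :
  2 * (1 - cos t) * (\sum_(j < m) dirichlet t j) = 1 - cos (m%:R * t).
Proof.
elim: m => [|m IH]; first by rewrite big_ord0 mul0r cos0; ring.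
by rewrite big_ord_recr /= mulrDr IH dirichletE; ring.
Qed.

Lemma cos_lt1 t : 0 < t < 2 * pi -> cos t < 1.
Proof.
move=> /andP[t0 t2].
have -> : t = (t / 2) *+ 2 by rewrite -mulr_natr; field.
rewrite cos_mulr2n cos2sin2.
have : 0 < sin (t / 2) by apply: sin_gt0_pi; lra.
move: (sin _) => s s0; have : 0 < s ^+ 2 by rewrite exprn_gt0.
by rewrite -mulr_natr; lra.
Qed.

Lemma fejer_bounds d t m : 0 < d -> d <= t -> t <= pi ->
  0 <= \sum_(j < m) dirichlet t j <= (1 - cos d)^-1.
Proof.
move=> d0 dt tp; have pi0 := pi_gt0 R.
have cd : cos d < 1 by apply: cos_lt1; lra.
have ct : cos t <= cos d by rewrite leNgt ltr_cos ?in_itv /=; lra.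
have := fejerE t m; move: (\sum_(j < m) _) => A hA.
have c1 := cos_le1 (m%:R * t); have c2 := cos_geN1 (m%:R * t).
have A0 : 0 <= A.
  by rewrite -(@pmulr_rge0 _ (2 * (1 - cos t))) ?hA; lra.
rewrite A0 -[_^-1]mul1r ler_pdivlMr; last lra.
apply: (@le_trans _ _ (A * (1 - cos t))); first by apply: ler_wpM2l; lra.
lra.
Qed.

Lemma MVT_everywhere (f f' : R -> R) (a b : R) :
  (forall x : R, is_derive x 1 f (f' x)) -> a <= b ->
  exists c, [/\ a <= c, c <= b & f b - f a = f' c * (b - a)].
Proof.
move=> df ab.
have cf : {within `[a, b], continuous f}.
  by apply: derivable_within_continuous => x _; apply: ex_derive.
have [c] := @MVT_segment R f f' a b ab (fun x _ => df x) cf.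
rewrite in_itv /= => /andP[ac cb] ->; by exists c.
Qed.

Lemma is_derive_cos_gap t m :
  is_derive t 1 (fun t => cos_gap t m) (cos_gap' t m).
Proof.
elim: m => [|m IH].
  rewrite /cos_gap /cos_gap' /cos_sum; under eq_fun do rewrite big_ord0.
  rewrite big_ord0; apply: is_derive_eq.
  rewrite /GRing.scale /=.
  by field.
have -> : (fun t => cos_gap t m.+1) = (fun t => cos_gap t m +
    (1 - cos (m.+1%:R * t)) / m.+1%:R ^+ 2).
  by apply/funext => s; rewrite /cos_gap /cos_sum big_ord_recr /=; ring.
apply: is_derive_eq.
rewrite /cos_gap' big_ord_recr /= /GRing.scale /=.
have : m.+1%:R != 0 :> R by rewrite pnatr_eq0.
move=> h; by field.
Qed.

Lemma is_derive_cos_gap' t m :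
  is_derive t 1 (fun t => cos_gap' t m) (dirichlet t m).
Proof.
elim: m => [|m IH].
  rewrite /cos_gap' /dirichlet; under eq_fun do rewrite big_ord0.
  rewrite big_ord0; apply: is_derive_eq.
  by rewrite /GRing.scale /=; field.
have -> : (fun t => cos_gap' t m.+1) = (fun t => cos_gap' t m +
    sin (m.+1%:R * t) / m.+1%:R).
  by apply/funext => s; rewrite /cos_gap' big_ord_recr /=; ring.
apply: is_derive_eq.
rewrite /dirichlet big_ord_recr /= /GRing.scale /=.
have : m.+1%:R != 0 :> R by rewrite pnatr_eq0.
move=> h; by field.
Qed.

Lemma is_derive_sum_ord (f f' : R -> nat -> R) :
  (forall (t : R) m, is_derive t 1 (fun t => f t m) (f' t m)) ->
  forall m t, is_derive t 1 (fun t => \sum_(j < m) f t j) (\sum_(j < m) f' t j).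
Proof.
move=> df; elim=> [|m IH] t.
  rewrite big_ord0; under eq_fun do rewrite big_ord0; exact: is_derive_cst.
have -> : (fun t => \sum_(j < m.+1) f t j) = (fun t => \sum_(j < m) f t j + f t m).
  by apply/funext => s; rewrite big_ord_recr.
rewrite big_ord_recr /=; exact: is_deriveD.
Qed.

Lemma sin_natpi n : sin (n%:R * pi) = 0 :> R.
Proof.
elim: n => [|n IH]; first by rewrite mul0r sin0.
by rewrite -natr1 mulrDl mul1r sinDpi IH oppr0.
Qed.

Lemma cos_sum_ge0 t m : 0 <= cos_sum t m.
Proof.
apply: sumr_ge0 => k _; apply: divr_ge0; last exact: exprn_ge0.
by have := cos_le1 (k.+1%:R * t); lra.
Qed.

Lemma cos_gap_mono t j m : (j <= m)%N -> cos_gap t j <= cos_gap t m.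
Proof.
move=> jm; rewrite /cos_gap !lerB // lerD2r /cos_sum -!(big_mkord xpredT
  (fun k => (1 - cos (k.+1%:R * t)) / k.+1%:R ^+ 2)).
rewrite (big_cat_nat (leq0n j) jm) /= lerDl; apply: sumr_ge0 => k _.
apply: divr_ge0; last exact: exprn_ge0.
by have := cos_le1 (k.+1%:R * t); lra.
Qed.

(** The point [pi] is critical for every [cos_gap], because [sin (k * pi) = 0];
    so the mean value theorem, applied between [t] and [pi], turns the bound on the
    Fejer kernel into a bound on the derivative. *)
Lemma cos_gap'_sum_bound d t m : 0 < d -> d <= t -> t <= pi ->
  `| \sum_(j < m) cos_gap' t j | <= pi / (1 - cos d).
Proof.
move=> d0 dt tp; have pi0 := pi_gt0 R.
have [c [tc cp]] := MVT_everywhere (is_derive_sum_ord is_derive_cos_gap' m) tp.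
rewrite big1 ?sub0r => [|j _]; last first.
  rewrite /cos_gap' subrr mul0r addr0 big1 // => k _.
  by rewrite sin_natpi mul0r.
move=> h; have /andP[A0 A1] : 0 <= \sum_(j < m) dirichlet c j <= (1 - cos d)^-1.
  by apply: fejer_bounds => //; lra.
rewrite -normrN h normrM !ger0_norm ?subr_ge0 // mulrC.
by apply: ler_pM => //; lra.
Qed.

(** On [[d, pi]] the sum of the first gaps varies by at most a constant, by
    [cos_gap'_sum_bound], and at [d] each gap is at least [- (pi * d / 2)] since
    its cosine sum is nonnegative. As the gaps increase with their index, the last
    one is at least the average. *)
Lemma cos_gap_ge d t m : 0 < d -> d <= t -> t <= pi ->
  - (pi * d / 2) - (pi ^+ 2 / (1 - cos d)) / m.+1%:R <= cos_gap t m.+1.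
Proof.
move=> d0 dt tp; have pi0 := pi_gt0 R.
set C := pi ^+ 2 / (1 - cos d).
have cd : cos d < 1 by apply: cos_lt1; lra.
have low : - (m.+1%:R * (pi * d / 2)) <= \sum_(j < m.+1) cos_gap d j.
  have -> : - (m.+1%:R * (pi * d / 2)) = \sum_(j < m.+1) - (pi * d / 2).
    by rewrite sumr_const card_ord mulNrn mulr_natl.
  apply: ler_sum => j _; rewrite /cos_gap.
  by have := cos_sum_ge0 d j; have := sqr_ge0 d; lra.
have up : \sum_(j < m.+1) cos_gap t j <= m.+1%:R * cos_gap t m.+1.
  have -> : m.+1%:R * cos_gap t m.+1 = \sum_(j < m.+1) cos_gap t m.+1.
    by rewrite sumr_const card_ord mulr_natl.
  by apply: ler_sum => j _; apply: cos_gap_mono; exact: ltnW.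
have dif : \sum_(j < m.+1) cos_gap d j - C <= \sum_(j < m.+1) cos_gap t j.
  have [c [dc ct h]] :=
    MVT_everywhere (is_derive_sum_ord is_derive_cos_gap m.+1) dt.
  suff : `|(\sum_(j < m.+1) cos_gap' c j) * (t - d)| <= C.
    by rewrite -h ler_norml => /andP[]; lra.
  rewrite normrM /C expr2 mulrAC.
  apply: ler_pM => //.
    by apply: cos_gap'_sum_bound => //; lra.
  by rewrite ger0_norm; lra.
have m0 : 0 < m.+1%:R :> R by rewrite ltr0n.
rewrite -(ler_pM2l m0) mulrBr [_ * (C / _)]mulrC divfK ?gt_eqF //.
by rewrite mulrN; lra.
Qed.

Lemma cos_2pi_sym n t : cos (n%:R * (2 * pi - t)) = cos (n%:R * t).
Proof.
rewrite mulrBr cosB.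
have -> : n%:R * (2 * pi) = (n * 2)%:R * pi :> R by rewrite natrM mulrA.
rewrite sin_natpi mul0r addr0.
suff -> : cos ((n * 2)%:R * pi) = 1 :> R by rewrite mul1r.
elim: n => [|n IH]; first by rewrite mul0r cos0.
have -> : (n.+1 * 2)%:R * pi = (n * 2)%:R * pi + pi *+ 2 :> R.
  by rewrite mulSn natrD mulrDl addrC (mulr_natl _ 2).
by rewrite cosD cos2pi sin2pi IH; ring.
Qed.

Lemma cos_gap_sym t m : cos_gap (2 * pi - t) m = cos_gap t m.
Proof.
rewrite /cos_gap /cos_sum; under eq_bigr do rewrite cos_2pi_sym.
by field.
Qed.

(** In [cos_gap_ge] a small [d] makes the first term small; then a large [m] makes
    the second one small. The symmetry [t |-> 2 * pi - t] covers [t > pi]. *)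
Lemma cos_gap_lower t : 0 < t < 2 * pi ->
  forall e : R, 0 < e -> \forall m \near \oo, - e < cos_gap t m.
Proof.
move=> t02 e e0; have pi0 := pi_gt0 R.
wlog tp : t t02 / t <= pi.
  move=> H; have [|tp] := leP t pi; first exact: H.
  have t02' : 0 < 2 * pi - t < 2 * pi by lra.
  have := H _ t02' ltac:(lra).
  by apply: filterS => m; rewrite cos_gap_sym.
(* This makes [pi * d / 2] at most [e / 2], and keeps [d] below [t]. *)
pose d := Num.min t (e / pi).
have d0 : 0 < d by rewrite /d lt_min divr_gt0 //; case/andP: t02 => ->.
have dt : d <= t by rewrite /d ge_min lexx.
have de : pi * d / 2 <= e / 2.
  rewrite ler_pM2r; last by lra.
  by rewrite mulrC -ler_pdivlMr // /d ge_min lexx orbT.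
have cd : cos d < 1 by apply: cos_lt1; lra.
set C := pi ^+ 2 / (1 - cos d).
have hC : C / m.+1%:R @[m --> \oo] --> C * 0.
  by apply: cvgM; [exact: cvg_cst | exact: cvg_harmonic].
have [N _ hN] : \forall m \near \oo, C / m.+1%:R < e / 2.
  by apply: (cvgr_lt _ hC); rewrite mulr0; lra.
exists N.+1 => // -[|m] //= Nm.
apply: lt_le_trans (cos_gap_ge m d0 dt tp); rewrite -/C.
have := hN m Nm; rewrite /=; move: (C / _) => q; lra.
Qed.

End CosineSeries.

(** * Symmetric sums over the integers *)

Section SymmetricSums.

Definition box (m : nat) : seq int := [seq k%:Z - m%:Z | k <- index_iota 0 m.*2.+1].

Lemma box_uniq m : uniq (box m).
Proof. by rewrite map_inj_uniq ?iota_uniq// => i j; lia. Qed.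

Lemma mem_box m (n : int) : (n \in box m) = (`|n| <= m)%N.
Proof.
apply/mapP/idP => [[k]|nm]; first by rewrite mem_index_iota => ? ->; lia.
by exists `|(n + m%:Z)%R|%N; rewrite ?mem_index_iota; lia.
Qed.

Definition symsum (V : nmodType) (f : int -> V) (m : nat) : V :=
  \sum_(k < m.*2.+1) f (k%:Z - m%:Z).

Lemma symsumE (V : nmodType) (f : int -> V) m :
  symsum f m = \sum_(n <- box m) f n.
Proof.
by rewrite /symsum /box big_map big_mkord.
Qed.

Lemma symsum0 (V : nmodType) (f : int -> V) : symsum f 0 = f 0.
Proof. by rewrite /symsum big_ord_recl big_ord0 addr0. Qed.

Lemma symsumS (V : nmodType) (f : int -> V) m :
  symsum f m.+1 = symsum f m + (f m.+1%:Z + f (- m.+1%:Z)).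
Proof.
rewrite /symsum doubleS big_ord_recl big_ord_recr /= addrC -addrA.
congr (_ + (f _ + f _)).
- by apply: eq_bigr => k _; congr f; rewrite /bump /=; lia.
- by rewrite /bump /=; lia.
- lia.
Qed.

Lemma eq_symsum (V : nmodType) (f g : int -> V) m :
  f =1 g -> symsum f m = symsum g m.
Proof. by move=> fg; apply: eq_bigr => k _. Qed.

Lemma eq_symsum_box (V : nmodType) (u v : int -> V) m :
  (forall n, (`|n| <= m)%N -> u n = v n) -> symsum u m = symsum v m.
Proof.
move=> uv; rewrite !symsumE big_seq [RHS]big_seq; apply: eq_bigr => n.
by rewrite mem_box => /uv.
Qed.

Lemma symsum_opp (V : nmodType) (f : int -> V) m :
  symsum (fun k => f (- k)) m = symsum f m.
Proof.
elim: m => [|m IH]; first by rewrite !symsum0 oppr0.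
by rewrite !symsumS IH opprK [f _ + f _]addrC.
Qed.

Lemma symsumD (V : nmodType) (f g : int -> V) m :
  symsum (fun n => f n + g n) m = symsum f m + symsum g m.
Proof. exact: big_split. Qed.

Variable R : realType.
Implicit Types f g : int -> R.

Lemma symsumMl (c : R) f m : symsum (fun n => c * f n) m = c * symsum f m.
Proof. by rewrite /symsum mulr_sumr. Qed.

Lemma le_symsum f g m : (forall n, f n <= g n) -> symsum f m <= symsum g m.
Proof. by move=> fg; apply: ler_sum => k _. Qed.

Lemma symsum_ge0 f m : (forall n, 0 <= f n) -> 0 <= symsum f m.
Proof. by move=> f0; apply: sumr_ge0 => k _. Qed.

Lemma symsum_term_le f (n : int) m : (forall n, 0 <= f n) -> (`|n| <= m)%N ->
  f n <= symsum f m.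
Proof.
move=> f0; rewrite -mem_box symsumE => nm.
by rewrite (bigD1_seq n) ?box_uniq//= lerDl sumr_ge0.
Qed.

Lemma symsum_nondecreasing f :
  (forall n, 0 <= f n) -> nondecreasing_seq (symsum f).
Proof.
by move=> f0; apply/nondecreasing_seqP => m; rewrite symsumS lerDl addr_ge0.
Qed.

(** The sum over the injective image of a finite range is one of the finite sums
    whose supremum is the unordered sum. The injection is a translation or a
    reflection when it comes from a convolution. *)
Lemma symsum_inj_le_esum f (e : int -> int) m : injective e ->
    (forall n, 0 <= f n) ->
  ((symsum (f \o e) m)%:E <= \esum_(n in [set: int]) (f n)%:E)%E.
Proof.
move=> ie f0; apply: esum_ge; exists [set` map e (box m)].
  by split => //; exact: finite_seq.
rewrite -fsbig_seq; last by rewrite map_inj_uniq ?box_uniq.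
rewrite big_map symsumE sumEFin.
exact: lexx.
Qed.

Lemma symsum_le_esum f m : (forall n, 0 <= f n) ->
  ((symsum f m)%:E <= \esum_(n in [set: int]) (f n)%:E)%E.
Proof. exact: (@symsum_inj_le_esum f id). Qed.

(** A finite set of integers lies in some symmetric range, so the symmetric
    partial sums of a nonnegative family are cofinal among its finite sums. *)
Lemma esum_le_symsum f (s : R) : (forall n, 0 <= f n) ->
    (forall m, symsum f m <= s) ->
  (\esum_(n in [set: int]) (f n)%:E <= s%:E)%E.
Proof.
move=> f0 fs; apply: ge_ereal_sup => _ [A [finA _] <-].
have [m Am] : exists m : nat, forall n, A n -> (`|n| <= m)%N.
  have /finite_seqP[s' ->] := finA.
  exists (\max_(n <- s') `|n|%N) => n ns.
  exact: (leq_bigmax_seq (P := predT) (F := absz) n).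
apply: (@le_trans _ _ (symsum f m)%:E); last by rewrite lee_fin.
rewrite symsumE -sumEFin [leRHS]fsbig_seq ?box_uniq//.
apply: lee_fsum_nneg_subset => //; last by move=> n _; rewrite lee_fin.
  by move=> n; rewrite !inE => /Am; rewrite -mem_box.
Qed.

Lemma symsum_cvg_fine f : (forall n, 0 <= f n) ->
    (\esum_(n in [set: int]) (f n)%:E < +oo)%E ->
  symsum f m @[m --> \oo] --> fine (\esum_(n in [set: int]) (f n)%:E).
Proof.
move=> f0 fin; set E := esum _ _.
have EE : E = (fine E)%:E.
  by rewrite fineK// ge0_fin_numE ?esum_ge0// => n _; rewrite lee_fin.
have fE m : symsum f m <= fine E.
  by rewrite -lee_fin -EE; exact: symsum_le_esum.
have fub : has_ubound (range (symsum f)) by exists (fine E) => _ [m _ <-].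
have fc := nondecreasing_cvgn (symsum_nondecreasing f0) fub.
suff <- : sup (range (symsum f)) = fine E by [].
apply/eqP; rewrite eq_le; apply/andP; split.
  by apply: ge_sup => [|_ [m _ <-]//]; exists (symsum f 0), 0%N.
rewrite -lee_fin -EE; apply: esum_le_symsum => // m.
by apply: ub_le_sup => //; exists m.
Qed.

Lemma esum_symsum_cvg f (s : R) : (forall n, 0 <= f n) ->
    symsum f m @[m --> \oo] --> s ->
  \esum_(n in [set: int]) (f n)%:E = s%:E.
Proof.
move=> f0 fs.
have fle m : symsum f m <= s.
  rewrite -(cvg_lim _ fs)//; apply: nondecreasing_cvgn_le.
    exact: symsum_nondecreasing.
  by apply/cvg_ex; exists s.
have fin : (\esum_(n in [set: int]) (f n)%:E < +oo)%E.
  exact: le_lt_trans (esum_le_symsum f0 fle) (ltry _).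
have h := symsum_cvg_fine f0 fin.
have <- := cvg_unique _ h fs => //.
by rewrite fineK// ge0_fin_numE ?esum_ge0// => n _; rewrite lee_fin.
Qed.

(** A translation permutes the integers, so it preserves the unordered sum,
    which for a nonnegative family is the limit of the symmetric sums. *)
Lemma symsum_shift_cvg0 f (k : int) (B : R) : (forall n, 0 <= f n) ->
    (forall m, symsum f m <= B) ->
  exists2 l : R, symsum f m @[m --> \oo] --> l &
    symsum (fun n => f (n - k)) m @[m --> \oo] --> l.
Proof.
move=> f0 fB.
have fin : (\esum_(n in [set: int]) (f n)%:E < +oo)%E.
  exact: le_lt_trans (esum_le_symsum f0 fB) (ltry _).
exists (fine (\esum_(n in [set: int]) (f n)%:E)); first exact: symsum_cvg_fine.
have E : \esum_(n in [set: int]) (f n)%:E =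
    \esum_(n in [set: int]) (f (n - k))%:E.
  apply: (reindex_esum setT setT (fun n => n - k)); split => //.
    by move=> i j _ _; lia.
  by move=> n _; exists (n + k) => //; lia.
rewrite E; apply: symsum_cvg_fine => //.
by rewrite -E.
Qed.

(** The nonnegative case applies to both terms of [f = (f + |f|) - |f|]. *)
Lemma symsum_shift_cvg f (k : int) (B : R) :
    (forall m, symsum (fun n => `|f n|) m <= B) ->
  exists2 l : R, symsum f m @[m --> \oo] --> l &
    symsum (fun n => f (n - k)) m @[m --> \oo] --> l.
Proof.
move=> fB.
have [l1 a1 b1] := symsum_shift_cvg0 k (fun n => normr_ge0 (f n)) fB.
have [l2 a2 b2] : exists2 l : R,
    symsum (fun n => f n + `|f n|) m @[m --> \oo] --> l &
    symsum (fun n => f (n - k) + `|f (n - k)|) m @[m --> \oo] --> l.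
  apply: (@symsum_shift_cvg0 (fun n => f n + `|f n|) k (B + B)).
    by move=> n; have := ler_norm (- f n); rewrite normrN; lra.
  move=> m; rewrite symsumD; apply: lerD (fB m).
  by apply: le_trans (fB m); apply: le_symsum => n; exact: ler_norm.
exists (l2 - l1).
  have -> : symsum f = fun m => symsum (fun n => f n + `|f n|) m -
      symsum (fun n => `|f n|) m.
    by apply/funext => m; rewrite symsumD addrK.
  exact: cvgB.
have -> : symsum (fun n => f (n - k)) = fun m =>
    symsum (fun n => f (n - k) + `|f (n - k)|) m -
    symsum (fun n => `|f (n - k)|) m.
  by apply/funext => m; rewrite symsumD addrK.
exact: cvgB.
Qed.

End SymmetricSums.

(** * Convolution filters *)

Section ComplexParts.
Local Open Scope complex_scope.
Variable R : realType.
Implicit Types z w : R[i].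

Lemma Re_add z w : complex.Re (z + w) = complex.Re z + complex.Re w.
Proof. by case: z; case: w. Qed.

Lemma Im_add z w : complex.Im (z + w) = complex.Im z + complex.Im w.
Proof. by case: z; case: w. Qed.

Lemma Re_mul z w : complex.Re (z * w) =
  complex.Re z * complex.Re w - complex.Im z * complex.Im w.
Proof. by case: z; case: w. Qed.

Lemma Im_mul z w : complex.Im (z * w) =
  complex.Re z * complex.Im w + complex.Im z * complex.Re w.
Proof. by case: z; case: w. Qed.

Lemma Re_conjc (z : R[i]) : complex.Re (conjc z) = complex.Re z.
Proof. by case: z. Qed.

Lemma Im_conjc (z : R[i]) : complex.Im (conjc z) = - complex.Im z.
Proof. by case: z. Qed.

Lemma mulr_realC (x y k : R) :
  (x +i* y) * k%:C = (x * k) +i* (y * k).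
Proof.
by apply/eqP; rewrite eq_complex /=; apply/andP; split; apply/eqP; ring.
Qed.

Lemma normc_ge0 z : 0 <= normc z.
Proof. by case: z => x y; exact: sqrtr_ge0. Qed.

Lemma normc_sqr z : normc z ^+ 2 = complex.Re z ^+ 2 + complex.Im z ^+ 2.
Proof. by case: z => x y /=; rewrite sqr_sqrtr// addr_ge0 ?sqr_ge0. Qed.

Lemma normc_sqrC (z : R[i]) : z * conjc z = (normc z ^+ 2)%:C.
Proof.
by rewrite normc_sqr; case: z => p q; apply/eqP;
  rewrite eq_complex /=; apply/andP; split; apply/eqP; ring.
Qed.

Lemma normc_Re z : `|complex.Re z| <= normc z.
Proof.
rewrite -ler_sqr ?nnegrE ?normc_ge0// normc_sqr real_normK ?num_real//.
by rewrite lerDl sqr_ge0.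
Qed.

Lemma normc_Im z : `|complex.Im z| <= normc z.
Proof.
rewrite -ler_sqr ?nnegrE ?normc_ge0// normc_sqr real_normK ?num_real//.
by rewrite lerDr sqr_ge0.
Qed.

Lemma Re_symsum (f : int -> R[i]) m :
  complex.Re (symsum f m) = symsum (fun n => complex.Re (f n)) m.
Proof. by apply: (big_morph _ Re_add). Qed.

Lemma Im_symsum (f : int -> R[i]) m :
  complex.Im (symsum f m) = symsum (fun n => complex.Im (f n)) m.
Proof. by apply: (big_morph _ Im_add). Qed.

Lemma normc_symsum (f : int -> R[i]) m :
  normc (symsum f m) <= symsum (fun n => normc (f n)) m.
Proof.
rewrite /symsum; elim/big_ind2: _ => [|x p y q xp yq|//]; first by rewrite normc0.
apply: (@le_trans _ _ (normc p + normc q)); [exact: le_normcD|exact: lerD].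
Qed.

Lemma symsumC (u : int -> R) m :
  symsum (fun n => (u n)%:C) m = (symsum u m)%:C :> R[i].
Proof. by rewrite /symsum raddf_sum. Qed.

Definition zcvg (f : int -> R[i]) (l : R[i]) : Prop :=
  symsum (fun n => complex.Re (f n)) m @[m --> \oo] --> complex.Re l /\
  symsum (fun n => complex.Im (f n)) m @[m --> \oo] --> complex.Im l.

Lemma zsum_eq f l : zcvg f l -> zsum f = l.
Proof.
case: l => l1 l2 [/= h1 h2]; rewrite /zsum; congr (_ +i* _); apply/cvg_lim => //.
  by under eq_fun do rewrite [X in complex.Re X]/(zpartial_sum _ _) Re_symsum.
by under eq_fun do rewrite [X in complex.Im X]/(zpartial_sum _ _) Im_symsum.
Qed.

Lemma zcvg_linear f g l k a : zcvg f l -> zcvg g k ->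
  zcvg (fun n => a * f n + g n) (a * l + k).
Proof.
move=> [f1 f2] [g1 g2].
have E m : symsum (fun n => a * f n + g n) m = a * symsum f m + symsum g m.
  by rewrite symsumD /symsum -mulr_sumr.
split.
  under eq_fun do rewrite -Re_symsum E Re_add Re_mul !Re_symsum Im_symsum.
  rewrite Re_add Re_mul; apply: cvgD => //.
  by apply: cvgB; apply: cvgM => //; exact: cvg_cst.
under eq_fun do rewrite -Im_symsum E Im_add Im_mul !Im_symsum Re_symsum.
rewrite Im_add Im_mul; apply: cvgD => //.
by apply: cvgD; apply: cvgM => //; exact: cvg_cst.
Qed.

(** The bound on the limit passes from the partial sums because the square of
    the modulus is a polynomial in the real and imaginary parts. *)
Lemma zcvg_shift (f : int -> R[i]) (k : int) (B : R) :
    (forall m, symsum (fun n => normc (f n)) m <= B) ->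
  exists l, [/\ zcvg f l, zcvg (fun n => f (n - k)) l & normc l <= B].
Proof.
move=> fB.
have [l1 a1 b1] := symsum_shift_cvg k (fun m => le_trans
  (le_symsum m (fun n => normc_Re (f n))) (fB m)).
have [l2 a2 b2] := symsum_shift_cvg k (fun m => le_trans
  (le_symsum m (fun n => normc_Im (f n))) (fB m)).
exists (l1 +i* l2); split => //.
have B0 : 0 <= B.
  by apply: le_trans (fB 0%N); apply: symsum_ge0 => n; exact: normc_ge0.
rewrite -ler_sqr ?nnegrE ?normc_ge0// normc_sqr /=.
have h : symsum (fun n => complex.Re (f n)) m ^+ 2 +
    symsum (fun n => complex.Im (f n)) m ^+ 2 @[m --> \oo] --> l1 ^+ 2 + l2 ^+ 2.
  by apply: cvgD; apply: cvgM.
rewrite -(cvg_lim _ h)//; apply: limr_le; first by apply/cvg_ex; exists (l1 ^+ 2 + l2 ^+ 2).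
apply: nearW => m; rewrite -Re_symsum -Im_symsum -normc_sqr.
rewrite ler_sqr ?nnegrE ?normc_ge0//.
exact: le_trans (normc_symsum f m) (fB m).
Qed.

End ComplexParts.

Section Filters.
Local Open Scope complex_scope.
Variable R : realType.
Implicit Types x h g : l2 R.

Lemma energy_fin x : energy x \is a fin_num.
Proof.
have /asboolP fin : `[< (energy x < +oo)%E >] by exact: (l2valP x).
by rewrite ge0_fin_numE// esum_ge0// => n _; rewrite lee_fin sqr_ge0.
Qed.

Lemma fine_energy_ge0 x : 0 <= fine (energy x).
Proof. by apply/fine_ge0/esum_ge0 => n _; rewrite lee_fin sqr_ge0. Qed.

Lemma l2norm_sqr x : l2norm x ^+ 2 = fine (energy x).
Proof. by rewrite sqr_sqrtr// fine_energy_ge0. Qed.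

Lemma l2norm_ge0 x : 0 <= l2norm x.
Proof. exact: sqrtr_ge0. Qed.

Lemma symsum_energy_inj x (e : int -> int) m : injective e ->
  symsum (fun k => normc (x (e k)) ^+ 2) m <= l2norm x ^+ 2.
Proof.
move=> ie; rewrite l2norm_sqr -lee_fin fineK ?energy_fin//.
exact: (@symsum_inj_le_esum _ (fun k => normc (x k) ^+ 2)
  e m ie (fun n => sqr_ge0 _)).
Qed.

Lemma symsum_energy_cvg x :
  symsum (fun k => normc (x k) ^+ 2) m @[m --> \oo] --> l2norm x ^+ 2.
Proof.
rewrite l2norm_sqr; apply: symsum_cvg_fine => [n|]; first exact: sqr_ge0.
by have /asboolP := l2valP x.
Qed.

Lemma normc_le_l2norm x n : normc (x n) <= l2norm x.
Proof.
rewrite -ler_sqr ?nnegrE ?normc_ge0 ?l2norm_ge0//.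
apply: le_trans _ (symsum_energy_inj x `|n|%N (@inj_id int)).
exact: (@symsum_term_le _ (fun k => normc (x k) ^+ 2) n _ (fun n => sqr_ge0 _)).
Qed.

(** The weights [H / X] and [X / H] in the inequality of arithmetic and
    geometric means make both terms equal to half of [X * H], where [X] and [H]
    are the two norms. *)
Lemma conv_cauchy_schwarz h x n m :
  symsum (fun k => normc (x k * h (n - k))) m <= l2norm x * l2norm h.
Proof.
under eq_symsum do rewrite normcM.
have [x0|x0] := eqVneq (l2norm x) 0.
  rewrite x0 mul0r /symsum big1// => k _.
  have := normc_le_l2norm x (k%:Z - m%:Z); rewrite x0 => le0.
  have -> : normc (x (k%:Z - m%:Z)) = 0 by apply/eqP; rewrite eq_le le0 normc_ge0.
  by rewrite mul0r.
have [h0|h0] := eqVneq (l2norm h) 0.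
  rewrite h0 mulr0 /symsum big1// => k _.
  have := normc_le_l2norm h (n - (k%:Z - m%:Z)); rewrite h0 => le0.
  have -> : normc (h (n - (k%:Z - m%:Z))) = 0.
    by apply/eqP; rewrite eq_le le0 normc_ge0.
  by rewrite mulr0.
have X0 : 0 < l2norm x by rewrite lt_def x0 l2norm_ge0.
have H0 : 0 < l2norm h by rewrite lt_def h0 l2norm_ge0.
have sx := symsum_energy_inj x m (@inj_id int).
have sh := symsum_energy_inj h m (subrI n).
set X := l2norm x in x0 X0 sx *; set H := l2norm h in h0 H0 sh *.
apply: (@le_trans _ _ (H / X / 2 * symsum (fun k => normc (x k) ^+ 2) m +
   X / H / 2 * symsum (fun k => normc (h (n - k)) ^+ 2) m)).
  rewrite -!symsumMl -symsumD; apply: le_symsum => k.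
  move: (normc (x k)) (normc (h _)) => p q; rewrite -subr_ge0.
  have -> : H / X / 2 * p ^+ 2 + X / H / 2 * q ^+ 2 - p * q =
    (H * p - X * q) ^+ 2 / (2 * X * H) by field; rewrite x0 h0.
  by rewrite divr_ge0 ?sqr_ge0// !mulr_ge0// ltW.
have -> : X * H = H / X / 2 * X ^+ 2 + X / H / 2 * H ^+ 2.
  by field; rewrite x0 h0.
by apply: lerD; apply: ler_wpM2l => //; rewrite !divr_ge0 ?ltW.
Qed.

Lemma conv_filter_cvg h x n :
  zcvg (fun k => x k * h (n - k)) (conv_filter h x n).
Proof.
have [l [hl _ _]] := zcvg_shift 0 (conv_cauchy_schwarz h x n).
by rewrite /conv_filter (zsum_eq hl).
Qed.

Lemma conv_filter_bound h x n :
  normc (conv_filter h x n) <= l2norm x * l2norm h.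
Proof.
have [l [hl _ le]] := zcvg_shift 0 (conv_cauchy_schwarz h x n).
by rewrite /conv_filter (zsum_eq hl).
Qed.

Lemma conv_filter_linear h : linear (conv_filter h).
Proof.
move=> a u v; apply/funext => n.
have := zcvg_linear a (conv_filter_cvg h u n) (conv_filter_cvg h v n).
move=> /zsum_eq E.
transitivity (a * conv_filter h u n + conv_filter h v n); last by [].
rewrite -E; congr zsum; apply/funext => k.
by rewrite mulrA -mulrDl; congr (_ * _).
Qed.

Lemma conv_filterB h g : conv_filter h - conv_filter g = conv_filter (h - g).
Proof.
apply/funext => x; apply/funext => n.
have := zcvg_linear (-1) (conv_filter_cvg g x n) (conv_filter_cvg h x n).
move=> /zsum_eq; rewrite mulN1r addrC => E.
transitivity (conv_filter h x n - conv_filter g x n); first by [].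
rewrite -E; congr zsum; apply/funext => k.
rewrite mulN1r -mulrN -mulrDr addrC; congr (_ * _).
Qed.

Lemma digital_conv_filter h : digital_filter (conv_filter h).
Proof.
split.
- exact: conv_filter_linear.
- by exists (l2norm h) => x n; rewrite mulrC conv_filter_bound.
- move=> k x y yx n.
  have [l [hl hs _]] := zcvg_shift k (conv_cauchy_schwarz h x (n - k)).
  rewrite [RHS](zsum_eq hl) -[RHS](zsum_eq hs); congr zsum.
  apply/funext => j; rewrite yx; congr (_ * h _); lia.
Qed.

Lemma l2norm0 : l2norm (0 : l2 R) = 0.
Proof.
by rewrite /l2norm /energy esum1 ?sqrtr0// => n _; rewrite normc0 expr0n.
Qed.

Lemma linfnorm_le (y : signal R) (B : R) :
  (forall n, normc (y n) <= B) -> linfnorm y <= B.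
Proof.
move=> yB; apply: ge_sup => [|_ [n _ <-]//].
by exists (normc (y 0)), 0.
Qed.

Lemma linfnorm_ge (y : signal R) (B : R) n :
  (forall n, normc (y n) <= B) -> normc (y n) <= linfnorm y.
Proof.
move=> yB; apply: ub_le_sup; last by exists n.
by exists B => _ [k _ <-].
Qed.

Lemma l2norm_of_cvg x (s : R) : 0 <= s ->
  symsum (fun k => normc (x k) ^+ 2) m @[m --> \oo] --> s ->
  l2norm x = Num.sqrt s.
Proof.
move=> s0 hs; congr Num.sqrt.
by rewrite /energy (@esum_symsum_cvg _ _ s) => // n; rewrite sqr_ge0.
Qed.

(** The matched filter: convolving [h] with its reversed conjugate gives the
    energy of [h] at time 0, which is the equality case of Cauchy-Schwarz. *)
Definition matched_signal (c : R) h : signal R :=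
  fun k => (c%:C : R[i]) * conjc (h (- k)).

Lemma normc_matched c h k : normc (matched_signal c h k) ^+ 2 =
  c ^+ 2 * normc (h (- k)) ^+ 2.
Proof.
by rewrite /matched_signal !normc_sqr; case: (h _) => p q /=; ring.
Qed.

Lemma symsum_matched_cvg c h :
  symsum (fun k => normc (matched_signal c h k) ^+ 2) m @[m --> \oo]
    --> c ^+ 2 * l2norm h ^+ 2.
Proof.
under eq_fun do [under eq_symsum do rewrite normc_matched].
under eq_fun do rewrite symsumMl (symsum_opp (fun k => normc (h k) ^+ 2)).
by apply: cvgM; [exact: cvg_cst|exact: symsum_energy_cvg].
Qed.

Lemma matched_subproof c h : matched_signal c h \in @square_summable R.
Proof.
apply/asboolP; rewrite /energy.
by rewrite (esum_symsum_cvg _ (@symsum_matched_cvg c h)) ?ltry// => n; rewrite sqr_ge0.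
Qed.

Definition matched c h : l2 R := L2 (matched_subproof c h).

Lemma l2norm_matched c h : 0 <= c -> l2norm (matched c h) = c * l2norm h.
Proof.
move=> c0; rewrite (@l2norm_of_cvg (matched c h) _ _ (@symsum_matched_cvg c h)).
  by rewrite -exprMn sqrtr_sqr ger0_norm// mulr_ge0// l2norm_ge0.
by rewrite mulr_ge0// sqr_ge0.
Qed.

Lemma conv_matched c h :
  conv_filter h (matched c h) 0 = (c * l2norm h ^+ 2)%:C.
Proof.
apply: zsum_eq.
have E k : matched c h k * h (0 - k) = (c * normc (h (- k)) ^+ 2)%:C.
  rewrite /= /matched_signal sub0r normc_sqr; case: (h _) => p q /=.
  by apply/eqP; rewrite eq_complex /=; apply/andP; split; apply/eqP; ring.
split => /=.
  under eq_fun do [under eq_symsum do rewrite E /=].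
  under eq_fun do rewrite symsumMl (symsum_opp (fun k => normc (h k) ^+ 2)).
  by apply: cvgM; [exact: cvg_cst|exact: symsum_energy_cvg].
under eq_fun do [under eq_symsum do rewrite E /=].
under eq_fun do rewrite /symsum big1//.
exact: cvg_cst.
Qed.

(** The upper bound is Cauchy-Schwarz; the normalised matched signal attains it
    at time 0. *)
Lemma opnorm_conv_filter h : opnorm (conv_filter h) = l2norm h.
Proof.
have ub x n : l2norm x <= 1 -> normc (conv_filter h x n) <= l2norm h.
  move=> x1; apply: le_trans (conv_filter_bound h x n) _.
  by rewrite -[leRHS]mul1r ler_wpM2r// l2norm_ge0.
have hub : ubound [set linfnorm (conv_filter h x) | x in [set x | l2norm x <= 1]]
    (l2norm h).
  by move=> _ [x x1 <-]; apply: linfnorm_le => n; exact: ub.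
apply/eqP; rewrite eq_le; apply/andP; split.
  apply: ge_sup => //.
  by exists (linfnorm (conv_filter h 0)), 0 => //=; rewrite l2norm0.
have lb x : l2norm x <= 1 -> normc (conv_filter h x 0) <= opnorm (conv_filter h).
  move=> x1; apply: le_trans (linfnorm_ge 0 (fun n => ub x n x1)) _.
  by apply: ub_le_sup; [exists (l2norm h)|exists x].
have [h0|h0] := eqVneq (l2norm h) 0.
  rewrite h0; apply: le_trans (lb 0 _); first exact: normc_ge0.
  by rewrite l2norm0.
have H0 : 0 < l2norm h by rewrite lt_def h0 l2norm_ge0.
have /lb : l2norm (matched (l2norm h)^-1 h) <= 1.
  by rewrite l2norm_matched ?mulVf// invr_ge0 ltW.
rewrite conv_matched expr2 mulrA mulVf// mul1r /=.
by rewrite expr0n addr0 sqrtr_sqr gtr0_norm.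
Qed.

End Filters.

(** * Integrals of bounded complex functions over a period *)

Section BoundedMeasurable.
Variable R : realType.
Notation mu := (@lebesgue_measure R).
Implicit Types (f g : R -> R).

(** A class of functions closed under products and integrable over every
    bounded interval, so that expanding squares raises no integrability question.
    It contains the trigonometric functions and the indicators. *)
Definition bounded_meas f : Prop :=
  measurable_fun [set: R] f /\ exists C : R, forall w, `|f w| <= C.

Lemma bounded_meas_cst (c : R) : bounded_meas (fun=> c).
Proof. by split; [exact: measurable_cst|exists `|c|]. Qed.

Lemma bounded_measD f g : bounded_meas f -> bounded_meas g ->
  bounded_meas (fun w => f w + g w).
Proof.
move=> [mf [A fA]] [mg [B gB]]; split; first exact: measurable_funD.
by exists (A + B) => w; apply: le_trans (ler_normD _ _) (lerD _ _).
Qed.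

Lemma bounded_measM f g : bounded_meas f -> bounded_meas g ->
  bounded_meas (fun w => f w * g w).
Proof.
move=> [mf [A fA]] [mg [B gB]]; split; first exact: measurable_funM.
by exists (A * B) => w; rewrite normrM ler_pM.
Qed.

Lemma bounded_measB f g : bounded_meas f -> bounded_meas g ->
  bounded_meas (fun w => f w - g w).
Proof.
move=> hf hg.
have := bounded_measD hf (bounded_measM (bounded_meas_cst (-1)) hg).
by congr bounded_meas; apply/funext => w; rewrite mulN1r.
Qed.

Lemma continuous_mulcos (c : R) : continuous (fun w : R => cos (c * w)).
Proof.
move=> w; apply: (@continuous_comp _ _ _ (fun w : R => c * w) (@cos R)).
  by apply: cvgM; [exact: cvg_cst|exact: cvg_id].
exact: continuous_cos.
Qed.

Lemma continuous_mulsin (c : R) : continuous (fun w : R => sin (c * w)).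
Proof.
move=> w; apply: (@continuous_comp _ _ _ (fun w : R => c * w) (@sin R)).
  by apply: cvgM; [exact: cvg_cst|exact: cvg_id].
exact: continuous_sin.
Qed.

Lemma bounded_meas_cos (c : R) : bounded_meas (fun w => cos (c * w)).
Proof.
split; first by apply: continuous_measurable_fun; exact: continuous_mulcos.
by exists 1 => w; exact: cos_max.
Qed.

Lemma bounded_meas_sin (c : R) : bounded_meas (fun w => sin (c * w)).
Proof.
split; first by apply: continuous_measurable_fun; exact: continuous_mulsin.
by exists 1 => w; exact: sin_max.
Qed.

Lemma bounded_meas_indic (a b : R) : bounded_meas (\1_(`[a, b] : set R)).
Proof.
split; first exact: measurable_indic.
by exists 1 => w; rewrite indicE; case: (_ \in _); rewrite ?normr1 ?normr0.
Qed.

Lemma bounded_meas_integrable f (a b : R) : bounded_meas f ->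
  mu.-integrable `]a, b[ (EFin \o f).
Proof.
move=> [mf [C fC]]; apply: measurable_bounded_integrable => //.
- rewrite /= lebesgue_measure_itv /=; case: ifP => // _.
  by rewrite -EFinB ltry.
- exact: measurable_funS mf.
- exists C; split; first exact: num_real.
  by move=> M CM w _; apply: le_trans (fC w) (ltW CM).
Qed.

Lemma Rintegral_FTC (F f : R -> R) (a b : R) : a < b ->
    (forall x : R, is_derive x 1 F (f x)) -> bounded_meas f -> continuous f ->
  \int[mu]_(x in `]a, b[) f x = F b - F a.
Proof.
move=> ab dF [mf _] cf.
have cF : continuous F.
  move=> x; apply: differentiable_continuous; apply/derivable1_diffP.
  exact: ex_derive.
rewrite /Rintegral -(@integral_itv_bndoo _ a b (EFin \o f) true false); last first.
  by apply/measurable_EFinP; exact: measurable_funS mf.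
rewrite (@continuous_FTC2 _ f F) //.
- exact: continuous_subspaceT.
- split.
  + by move=> x _; exact: ex_derive.
  + by apply: cvg_at_right_filter; exact: cF.
  + by apply: cvg_at_left_filter; exact: cF.
- by move=> x _; rewrite derive1E; exact: derive_val.
Qed.

Lemma Rintegral_band (a b : R) f : is_band a b -> bounded_meas f ->
  \int[mu]_(w in `]0, 2 * pi[) (\1_(`[a, b] : set R) w * f w) =
  \int[mu]_(w in `]a, b[) f w.
Proof.
move=> [a0 ab bpi] [mf bf].
rewrite {2}/Rintegral -(@integral_itv_bndoo _ a b (EFin \o f) true false); last first.
  by apply/measurable_EFinP; exact: measurable_funS mf.
rewrite -[RHS]/(\int[mu]_(w in `[a, b]) f w).
rewrite [in RHS](_ : `[a, b]%classic = `]0, 2 * pi[ `&` `[a, b] :> set R); last first.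
  apply/seteqP; split => [w|w [] //]; rewrite /= !in_itv /= => /andP[aw wb].
  by split; apply/andP; split => //; lra.
rewrite Rintegral_mkcondr; apply: eq_Rintegral => w _.
by rewrite patchE indicE; case: (w \in _); rewrite ?mul1r ?mul0r.
Qed.

End BoundedMeasurable.

Section ComplexIntegral.
Local Open Scope complex_scope.
Variable R : realType.
Notation mu := (@lebesgue_measure R).
Implicit Types (f g : R -> R[i]).

Definition cbounded_meas f : Prop :=
  bounded_meas (fun w => complex.Re (f w)) /\
  bounded_meas (fun w => complex.Im (f w)).

Lemma eq_cbounded_meas f g : f =1 g -> cbounded_meas f -> cbounded_meas g.
Proof. by move=> /funext ->. Qed.

Lemma cbounded_meas_cst (c : R[i]) : cbounded_meas (fun=> c).
Proof. by split; exact: bounded_meas_cst. Qed.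

Lemma cbounded_measD f g : cbounded_meas f -> cbounded_meas g ->
  cbounded_meas (fun w => f w + g w).
Proof.
move=> [f1 f2] [g1 g2]; split.
  by under eq_fun do rewrite Re_add; exact: bounded_measD.
by under eq_fun do rewrite Im_add; exact: bounded_measD.
Qed.

Lemma cbounded_measM f g : cbounded_meas f -> cbounded_meas g ->
  cbounded_meas (fun w => f w * g w).
Proof.
move=> [f1 f2] [g1 g2]; split.
  by under eq_fun do rewrite Re_mul; apply: bounded_measB; exact: bounded_measM.
by under eq_fun do rewrite Im_mul; apply: bounded_measD; exact: bounded_measM.
Qed.

Lemma cbounded_measJ f : cbounded_meas f -> cbounded_meas (fun w => conjc (f w)).
Proof.
move=> [f1 f2]; split; first by under eq_fun do rewrite Re_conjc.
under eq_fun do rewrite Im_conjc -mulN1r.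
by apply: bounded_measM => //; exact: bounded_meas_cst.
Qed.

Lemma cbounded_meas_mode (n : int) :
  cbounded_meas (fun w => fourier_mode w n).
Proof.
split => /=; first exact: bounded_meas_cos.
under eq_fun do rewrite -mulN1r.
by apply: bounded_measM; [exact: bounded_meas_cst|exact: bounded_meas_sin].
Qed.

Lemma cbounded_meas_indic (a b : R) :
  cbounded_meas (fun w => (\1_(`[a, b] : set R) w)%:C).
Proof. by split; [exact: bounded_meas_indic|exact: bounded_meas_cst]. Qed.

Lemma cbounded_meas_symsum (F : int -> R -> R[i]) m :
  (forall n, cbounded_meas (F n)) ->
  cbounded_meas (fun w => symsum (fun n => F n w) m).
Proof.
move=> bF; elim: m => [|m IH].
  by under eq_fun do rewrite symsum0.
under eq_fun do rewrite symsumS.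
by apply: cbounded_measD => //; apply: cbounded_measD.
Qed.

Lemma bounded_meas_normc2 f : cbounded_meas f ->
  bounded_meas (fun w => normc (f w) ^+ 2).
Proof.
move=> [f1 f2]; under eq_fun do rewrite normc_sqr !expr2.
by apply: bounded_measD; exact: bounded_measM.
Qed.

Definition cintegral f : R[i] :=
  (\int[mu]_(w in `]0%R, (2 * pi)%R[) complex.Re (f w)) +i*
  (\int[mu]_(w in `]0%R, (2 * pi)%R[) complex.Im (f w)).

Lemma cintegralD f g : cbounded_meas f -> cbounded_meas g ->
  cintegral (fun w => f w + g w) = cintegral f + cintegral g.
Proof.
move=> [f1 f2] [g1 g2]; rewrite /cintegral.
under [X in X +i* _]eq_Rintegral do rewrite Re_add.
under [X in _ +i* X]eq_Rintegral do rewrite Im_add.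
by rewrite !RintegralD//; exact: bounded_meas_integrable.
Qed.

Lemma cintegralZ (c : R[i]) f : cbounded_meas f ->
  cintegral (fun w => c * f w) = c * cintegral f.
Proof.
move=> [f1 f2]; rewrite /cintegral.
have intZ (k : R) (g : R -> R) : bounded_meas g ->
    mu.-integrable `]0, 2 * pi[ (EFin \o (fun w => k * g w)).
  move=> bg; apply: bounded_meas_integrable.
  by apply: bounded_measM => //; exact: bounded_meas_cst.
under [X in X +i* _]eq_Rintegral do rewrite Re_mul.
under [X in _ +i* X]eq_Rintegral do rewrite Im_mul.
rewrite RintegralB ?RintegralD//; try exact: intZ.
by rewrite !RintegralZl//; try exact: bounded_meas_integrable; case: c.
Qed.

Lemma cintegral_conj f : cbounded_meas f ->
  cintegral (fun w => conjc (f w)) = conjc (cintegral f).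
Proof.
move=> [f1 f2]; rewrite /cintegral /=; congr (_ +i* _).
  by apply: eq_Rintegral => w _; exact: Re_conjc.
under eq_Rintegral do rewrite Im_conjc -mulN1r.
by rewrite RintegralZl ?mulN1r//; exact: bounded_meas_integrable.
Qed.

Lemma cintegral_symsum (F : int -> R -> R[i]) m :
  (forall n, cbounded_meas (F n)) ->
  cintegral (fun w => symsum (fun n => F n w) m) =
  symsum (fun n => cintegral (F n)) m.
Proof.
move=> bF; elim: m => [|m IH].
  by rewrite symsum0; under eq_fun do rewrite symsum0.
under eq_fun do rewrite symsumS.
rewrite symsumS cintegralD ?IH ?cintegralD//; last exact: cbounded_measD.
exact: cbounded_meas_symsum.
Qed.

Lemma mode_conjM (w : R) (j k : int) :
  fourier_mode w j * conjc (fourier_mode w k) = fourier_mode w (j - k).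
Proof.
rewrite /fourier_mode rmorphB /= mulrBl cosB sinB.
by apply/eqP; rewrite eq_complex /=; apply/andP; split; apply/eqP; ring.
Qed.

Lemma sin_intpi2 (n : int) : sin (n%:~R * (2 * pi)) = 0 :> R.
Proof.
have h (m : nat) : sin (m%:R * (2 * pi)) = 0 :> R.
  by rewrite mulrA -natrM sin_natpi.
by case: n => m; rewrite ?NegzE ?mulrNz ?mulNr ?sinN ?h ?oppr0 // -pmulrn h ?oppr0.
Qed.

Lemma cos_intpi2 (n : int) : cos (n%:~R * (2 * pi)) = 1 :> R.
Proof.
have h (m : nat) : cos (m%:R * (2 * pi)) = 1 :> R.
  by have := cos_2pi_sym m (0 : R); rewrite subr0 mulr0 cos0.
by case: n => m; rewrite ?NegzE ?mulrNz ?mulNr ?cosN ?h // -pmulrn h.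
Qed.

Lemma Rintegral_cos (n : int) (a b : R) : n != 0 -> a < b ->
  \int[mu]_(w in `]a, b[) cos (n%:~R * w) =
  (sin (n%:~R * b) - sin (n%:~R * a)) / n%:~R.
Proof.
move=> n0 ab; have n0' : n%:~R != 0 :> R by rewrite intr_eq0.
have dF (x : R) : is_derive x 1 (fun w => sin (n%:~R * w) / n%:~R) (cos (n%:~R * x)).
  by apply: is_derive_eq; rewrite /GRing.scale /=; field.
rewrite (Rintegral_FTC ab dF (bounded_meas_cos _) (@continuous_mulcos _ _)).
by field.
Qed.

Lemma Rintegral_sin (n : int) (a b : R) : n != 0 -> a < b ->
  \int[mu]_(w in `]a, b[) sin (n%:~R * w) =
  (cos (n%:~R * a) - cos (n%:~R * b)) / n%:~R.
Proof.
move=> n0 ab; have n0' : n%:~R != 0 :> R by rewrite intr_eq0.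
have dF (x : R) : is_derive x 1 (fun w => - (cos (n%:~R * w) / n%:~R)) (sin (n%:~R * x)).
  by apply: is_derive_eq; rewrite /GRing.scale /=; field.
rewrite (Rintegral_FTC ab dF (bounded_meas_sin _) (@continuous_mulsin _ _)).
by field.
Qed.

Lemma Rintegral_one (a b : R) : a < b -> \int[mu]_(w in `]a, b[) (1 : R) = b - a.
Proof.
by move=> ab; rewrite Rintegral_cst//= lebesgue_measure_itv /= lte_fin ab mul1r.
Qed.

Lemma cintegral_mode (n : int) :
  cintegral (fun w => fourier_mode w n) = if n == 0 then (2 * pi)%:C else 0.
Proof.
have pi0 : 0 < 2 * pi :> R by rewrite mulr_gt0// pi_gt0.
rewrite /cintegral /fourier_mode /=.
under [X in _ +i* X]eq_Rintegral do rewrite -mulN1r.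
rewrite RintegralZl//; last exact/bounded_meas_integrable/bounded_meas_sin.
case: eqVneq => [->|n0].
  under [X in X +i* _]eq_Rintegral do rewrite mul0r cos0.
  under [X in _ +i* (_ * X)]eq_Rintegral do rewrite mul0r sin0.
  by rewrite Rintegral_one// Rintegral_cst// mul0r mulr0 subr0.
rewrite Rintegral_cos// Rintegral_sin// !mulr0 sin_intpi2 cos_intpi2 sin0 cos0.
by rewrite !subrr !mul0r mulr0.
Qed.

(** The inner product of L^2(0, 2 pi), not normalised: the modes have squared
    norm [2 * pi]. *)
Definition ip f g : R[i] := cintegral (fun w => f w * conjc (g w)).

Definition trig_sum (c : int -> R[i]) m : R -> R[i] :=
  fun w => symsum (fun n => c n * fourier_mode w n) m.

Lemma cbounded_meas_trig c m : cbounded_meas (trig_sum c m).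
Proof.
apply: cbounded_meas_symsum => n; apply: cbounded_measM.
  exact: cbounded_meas_cst.
exact: cbounded_meas_mode.
Qed.

Lemma ip_conj f g : cbounded_meas f -> cbounded_meas g -> ip g f = conjc (ip f g).
Proof.
move=> bf bg; rewrite /ip -cintegral_conj; last first.
  by apply: cbounded_measM => //; exact: cbounded_measJ.
congr cintegral; apply/funext => w; rewrite rmorphM /= mulrC.
by rewrite conjcK.
Qed.

Lemma ipBl f g k : cbounded_meas f -> cbounded_meas g -> cbounded_meas k ->
  ip (fun w => f w - g w) k = ip f k - ip g k.
Proof.
move=> bf bg bk; rewrite /ip -mulN1r -cintegralZ; last first.
  by apply: cbounded_measM => //; exact: cbounded_measJ.
rewrite -cintegralD; last 2 first.
- by apply: cbounded_measM => //; exact: cbounded_measJ.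
- apply: cbounded_measM; first exact: cbounded_meas_cst.
  by apply: cbounded_measM => //; exact: cbounded_measJ.
by congr cintegral; apply/funext => w; rewrite mulrBl mulN1r.
Qed.

Lemma ip_trigl c m f : cbounded_meas f ->
  ip (trig_sum c m) f = symsum (fun n => c n * ip (fun w => fourier_mode w n) f) m.
Proof.
move=> bf; rewrite /ip /trig_sum.
have bmf n : cbounded_meas (fun w => fourier_mode w n * conjc (f w)).
  by apply: cbounded_measM; [exact: cbounded_meas_mode|exact: cbounded_measJ].
transitivity (cintegral (fun w =>
    symsum (fun n => c n * (fourier_mode w n * conjc (f w))) m)).
  congr cintegral; apply/funext => w; rewrite /symsum mulr_suml.
  by apply: eq_bigr => k _; rewrite mulrA.
rewrite cintegral_symsum => [|n]; last first.
  by apply: cbounded_measM => //; exact: cbounded_meas_cst.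
by apply: eq_symsum => n; rewrite cintegralZ.
Qed.

Lemma ip_normc f : cbounded_meas f ->
  ip f f = (\int[mu]_(w in `]0, 2 * pi[) normc (f w) ^+ 2)%:C.
Proof.
move=> bf; rewrite /ip /cintegral; congr (_ +i* _).
  by apply: eq_Rintegral => w _; rewrite normc_sqr; case: (f w) => p q /=; ring.
under eq_Rintegral => w _.
  have -> : complex.Im (f w * conjc (f w)) = 0 by case: (f w) => p q /=; ring.
  over.
by rewrite Rintegral_cst// mul0r.
Qed.

End ComplexIntegral.

(** * Fourier coefficients, the ideal response and the distance *)

Section TrigonometricSums.
Local Open Scope complex_scope.
Variable R : realType.
Notation mu := (@lebesgue_measure R).
Implicit Types (f g : R -> R[i]) (c : int -> R[i]).

Lemma ip_mode (j k : int) :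
  ip (fun w => fourier_mode w j) (fun w => fourier_mode w k) =
  if j == k then (2 * pi)%:C else 0 :> R[i].
Proof.
rewrite -subr_eq0 -cintegral_mode; congr cintegral.
by apply/funext => w; exact: mode_conjM.
Qed.

Lemma ip_trig_mode c m (n : int) : (`|n| <= m)%N ->
  ip (trig_sum c m) (fun w => fourier_mode w n) = c n * (2 * pi)%:C.
Proof.
move=> nm; rewrite ip_trigl; last exact: cbounded_meas_mode.
rewrite symsumE (bigD1_seq n) ?box_uniq ?mem_box//= big1 => [|k kn].
  by rewrite ip_mode eqxx addr0.
by rewrite ip_mode (negbTE kn) mulr0.
Qed.

Lemma ip_trig_coef c m f : cbounded_meas f ->
    (forall n, ip f (fun w => fourier_mode w n) = c n * (2 * pi)%:C) ->
  ip (trig_sum c m) f = (2 * pi * symsum (fun n => normc (c n) ^+ 2) m)%:C.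
Proof.
move=> bf fc; rewrite ip_trigl// -symsumMl -symsumC; apply: eq_symsum => n.
rewrite ip_conj//; last exact: cbounded_meas_mode.
rewrite fc rmorphM /= mulrA normc_sqrC.
by apply/eqP; rewrite eq_complex /=; apply/andP; split; apply/eqP; ring.
Qed.

Lemma ip_trig_trig c m :
  ip (trig_sum c m) (trig_sum c m) =
  (2 * pi * symsum (fun n => normc (c n) ^+ 2) m)%:C.
Proof.
rewrite ip_trigl; last exact: cbounded_meas_trig.
rewrite -symsumMl -symsumC; apply: eq_symsum_box => n nm.
rewrite ip_conj; [|exact: cbounded_meas_trig|exact: cbounded_meas_mode].
rewrite ip_trig_mode// rmorphM /= mulrA normc_sqrC.
by apply/eqP; rewrite eq_complex /=; apply/andP; split; apply/eqP; ring.
Qed.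

Lemma trig_sum_energy c m :
  \int[mu]_(w in `]0, 2 * pi[) normc (trig_sum c m w) ^+ 2 =
  2 * pi * symsum (fun n => normc (c n) ^+ 2) m.
Proof.
have := ip_trig_trig c m; rewrite ip_normc; last exact: cbounded_meas_trig.
by case.
Qed.

(** Expanding the square: the cross terms and the energy of the partial sum are
    all equal to [2 * pi] times the sum of the squared coefficients. *)
Lemma bessel_defect c m f : cbounded_meas f ->
    (forall n, ip f (fun w => fourier_mode w n) = c n * (2 * pi)%:C) ->
  \int[mu]_(w in `]0, 2 * pi[) normc (trig_sum c m w - f w) ^+ 2 =
  \int[mu]_(w in `]0, 2 * pi[) normc (f w) ^+ 2 -
    2 * pi * symsum (fun n => normc (c n) ^+ 2) m.
Proof.
move=> bf fc; have bS := cbounded_meas_trig c m.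
set S := trig_sum c m in bS *; set s := symsum _ m.
have bSf : cbounded_meas (fun w => S w - f w).
  apply: (eq_cbounded_meas (f := fun w => S w + (-1) * f w)) => [w|].
    by rewrite mulN1r.
  by apply: cbounded_measD => //; apply: cbounded_measM => //;
    exact: cbounded_meas_cst.
have Sf : ip S f = (2 * pi * s)%:C by exact: ip_trig_coef.
have := ip_normc bSf.
rewrite ipBl// (ip_conj bSf bS) (ip_conj bSf bf) !ipBl//.
rewrite (ip_conj bS bf) Sf ip_trig_trig -/s ip_normc//.
case=> <- _; ring.
Qed.

End TrigonometricSums.

Section Transform.
Local Open Scope complex_scope.
Variable R : realType.
Notation mu := (@lebesgue_measure R).
Implicit Types (h g : l2 R) (H : R -> R[i]).

Definition dft_error h H m : R :=
  \int[mu]_(w in `]0, 2 * pi[) normc (trig_sum h m w - H w) ^+ 2.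

Lemma cbounded_meas_trigB (c : int -> R[i]) m H : cbounded_meas H ->
  cbounded_meas (fun w => trig_sum c m w - H w).
Proof.
move=> bH.
apply: (eq_cbounded_meas (f := fun w => trig_sum c m w + (-1) * H w)) => [w|].
  by rewrite mulN1r.
apply: cbounded_measD; first exact: cbounded_meas_trig.
by apply: cbounded_measM => //; exact: cbounded_meas_cst.
Qed.

Lemma is_dftP h H : cbounded_meas H ->
  is_dft h H <-> dft_error h H m @[m --> \oo] --> 0.
Proof.
move=> bH; split => [[_ _ /fine_cvg]//|cv].
split; [exact: measurable_funS bH.1.1|exact: measurable_funS bH.2.1|].
apply: cvg_EFin; last exact: cv.
apply: nearW => m.
apply: integrable_fin_num => //.
apply: bounded_meas_integrable; apply: bounded_meas_normc2.
exact: cbounded_meas_trigB.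
Qed.

(** The trigonometric sums of [h - g] have energy
    [2 * pi * symsum (fun k => normc (h k - g k) ^+ 2) m] by orthogonality, and it
    tends to 0 by the parallelogram inequality; each term of the sum is below it. *)
Lemma dft_unique h g H : cbounded_meas H -> is_dft h H -> is_dft g H -> h = g.
Proof.
move=> bH /(is_dftP _ bH) ch /(is_dftP _ bH) cg.
apply: val_inj; apply/funext => n.
apply/eqP; rewrite -subr_eq0; apply/eqP/eq0_normc/eqP.
change (normc (h n - g n) == 0).
rewrite -sqrf_eq0 eq_le sqr_ge0 andbT.
have c0 : 2 * dft_error h H m + 2 * dft_error g H m @[m --> \oo] --> (0 : R).
  have -> : 0 = 2 * 0 + 2 * 0 :> R by ring.
  by apply: cvgD; apply: cvgM => //; exact: cvg_cst.
apply: (cvgr_to_ge c0); exists `|n|%N => // m /= nm.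
pose c k := h k - g k.
apply: (@le_trans _ _ (2 * pi * symsum (fun k => normc (c k) ^+ 2) m)).
  apply: (@le_trans _ _ (symsum (fun k => normc (c k) ^+ 2) m)).
    exact: (@symsum_term_le _ (fun k => normc (c k) ^+ 2) n _ (fun k => sqr_ge0 _)).
  have := @symsum_ge0 _ (fun k => normc (c k) ^+ 2) m (fun k => sqr_ge0 _).
  by have := pi_ge2 R; nra.
rewrite -trig_sum_energy /dft_error.
have bi k : mu.-integrable `]0, 2 * pi[
    (EFin \o (fun w => normc (trig_sum (k : l2 R) m w - H w) ^+ 2)).
  by apply/bounded_meas_integrable/bounded_meas_normc2/cbounded_meas_trigB.
have bi2 k : mu.-integrable `]0, 2 * pi[
    (EFin \o (fun w => 2 * normc (trig_sum (k : l2 R) m w - H w) ^+ 2)).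
  apply/bounded_meas_integrable/bounded_measM; first exact: bounded_meas_cst.
  by apply/bounded_meas_normc2/cbounded_meas_trigB.
rewrite -!RintegralZl// -RintegralD//; apply: le_Rintegral => //.
- by apply/bounded_meas_integrable/bounded_meas_normc2/cbounded_meas_trig.
- apply/bounded_meas_integrable/bounded_measD; apply: bounded_measM;
    try exact: bounded_meas_cst;
    by apply/bounded_meas_normc2/cbounded_meas_trigB.
- move=> w _.
  have -> : trig_sum c m w = (trig_sum h m w - H w) - (trig_sum g m w - H w).
    have -> : trig_sum h m w = trig_sum c m w + trig_sum g m w.
      rewrite /trig_sum -symsumD; apply: eq_symsum => k.
      by rewrite -mulrDl subrK.
    ring.
  move: (_ - H w) (_ - H w) => [p q] [r s].
  rewrite !normc_sqr /=.
  by have := sqr_ge0 (p + r); have := sqr_ge0 (q + s); nra.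
Qed.

End Transform.

Section Band.
Local Open Scope complex_scope.
Variable R : realType.
Notation mu := (@lebesgue_measure R).
Variables (a b : R) (ab : is_band a b).

Let t := b - a.

(** The Fourier coefficients of the indicator of [[a, b]], that is
    [(2 * pi)^-1] times the integral of [exp (i * n * w)] over [[a, b]]. *)
Definition band_coef (n : int) : R[i] :=
  ((if n == 0 then b - a else (sin (n%:~R * b) - sin (n%:~R * a)) / n%:~R) /
    (2 * pi)) +i*
  ((cos (n%:~R * a) - cos (n%:~R * b)) / n%:~R / (2 * pi)).

Let indic w : R[i] := (\1_(`[a, b] : set R) w)%:C.

Lemma two_pi_neq0 : 2 * pi != 0 :> R.
Proof. by rewrite mulf_neq0// pi_neq0. Qed.

Lemma ip_indic_mode n :
  ip indic (fun w => fourier_mode w n) = band_coef n * (2 * pi)%:C.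
Proof.
have [a0 altb bpi] := ab; have pi0 := two_pi_neq0.
rewrite /ip /cintegral /indic.
under [X in X +i* _]eq_Rintegral do rewrite Re_mul Re_conjc /= mul0r subr0.
under [X in _ +i* X]eq_Rintegral do
  rewrite Im_mul Im_conjc /= mul0r addr0 opprK.
rewrite Rintegral_band//; last exact: bounded_meas_cos.
rewrite Rintegral_band//; last exact: bounded_meas_sin.
rewrite /band_coef; case: eqVneq => [->|n0].
  under [X in X +i* _]eq_Rintegral do rewrite mul0r cos0.
  under [X in _ +i* X]eq_Rintegral do rewrite mul0r sin0.
  rewrite Rintegral_one// Rintegral_cst// invr0 !mulr0 !mul0r.
  by rewrite mulr_realC divfK// mul0r.
by rewrite Rintegral_cos// Rintegral_sin// mulr_realC !divfK.
Qed.

Lemma normc_band_coef0 : normc (band_coef 0) ^+ 2 = t ^+ 2 / (4 * pi ^+ 2).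
Proof.
rewrite normc_sqr /= invr0 mulr0 mul0r expr0n addr0.
by move: (pi_neq0 R); rewrite /t; move: (pi : R) => p p0; field.
Qed.

Lemma normc_band_coef n : n != 0 ->
  normc (band_coef n) ^+ 2 =
  (1 - cos (n%:~R * t)) / (2 * pi ^+ 2 * n%:~R ^+ 2).
Proof.
move=> n0; rewrite normc_sqr /= (negbTE n0).
have n0' : n%:~R != 0 :> R by rewrite intr_eq0.
rewrite /t mulrBr cosB.
have := cos2Dsin2 (n%:~R * a); have := cos2Dsin2 (n%:~R * b).
move: (cos (n%:~R * b)) (sin (n%:~R * b)) => cb sb hb.
move: (cos (n%:~R * a)) (sin (n%:~R * a)) => ca sa ha.
have -> : 1 - (cb * ca + sb * sa) =
   ((cb ^+ 2 + sb ^+ 2) + (ca ^+ 2 + sa ^+ 2)) / 2 - (cb * ca + sb * sa).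
  by rewrite hb ha; field.
by move: (pi_neq0 R); move: (pi : R) => p p0; field; rewrite n0' p0.
Qed.

Lemma normc_band_coefN n : normc (band_coef (- n)) ^+ 2 = normc (band_coef n) ^+ 2.
Proof.
have [->|n0] := eqVneq n 0; first by rewrite oppr0.
by rewrite !normc_band_coef ?oppr_eq0// mulrNz mulNr cosN sqrrN.
Qed.

Lemma symsum_band_coef m :
  symsum (fun n => normc (band_coef n) ^+ 2) m =
  (t ^+ 2 / 4 + cos_sum t m) / pi ^+ 2.
Proof.
have p0 := pi_neq0 R.
elim: m => [|m IH].
  by rewrite symsum0 normc_band_coef0 /cos_sum big_ord0; field_pi.
rewrite symsumS IH normc_band_coefN normc_band_coef// /cos_sum big_ord_recr /=.
have m0 : m.+1%:~R != 0 :> R by rewrite intr_eq0.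
by rewrite -pmulrn; field_pi.
Qed.

Lemma band_dft_error m :
  \int[mu]_(w in `]0, 2 * pi[) normc (trig_sum band_coef m w - indic w) ^+ 2 =
  - (2 / pi) * cos_gap t m.
Proof.
have [a0 altb bpi] := ab.
have p0 := pi_neq0 R.
rewrite bessel_defect; [|exact: cbounded_meas_indic|exact: ip_indic_mode].
have -> : \int[mu]_(w in `]0, 2 * pi[) normc (indic w) ^+ 2 = t.
  rewrite /t -(Rintegral_one altb) -Rintegral_band//; last exact: bounded_meas_cst.
  apply: eq_Rintegral => w _; rewrite normc_sqr /= expr0n addr0 mulr1 indicE.
  by case: (_ \in _); rewrite ?expr1n ?expr0n.
by rewrite symsum_band_coef /cos_gap; field_pi.
Qed.

Lemma t_range : 0 < t < 2 * pi.
Proof. by have [a0 altb bpi] := ab; rewrite /t; lra. Qed.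

(** This is Bessel's inequality: the squared error is nonnegative. *)
Lemma cos_gap_le0_band m : cos_gap t m <= 0.
Proof.
have := band_dft_error m.
have : 0 <= \int[mu]_(w in `]0, 2 * pi[)
    normc (trig_sum band_coef m w - indic w) ^+ 2.
  by apply: Rintegral_ge0 => w _; exact: sqr_ge0.
by move=> + E; rewrite E mulNr oppr_ge0 pmulr_rle0// divr_gt0// pi_gt0.
Qed.

(** Bessel's inequality bounds the gap from above, the Fejer argument from
    below; together they are the Parseval identity of the indicator. *)
Lemma cos_gap_cvg0_band : cos_gap t m @[m --> \oo] --> 0.
Proof.
apply/cvgrPdist_lt => e e0; have := cos_gap_lower t_range e0.
apply: filterS => m; have := cos_gap_le0_band m.
by rewrite sub0r normrN => g0; rewrite ler0_norm//; lra.
Qed.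

Lemma symsum_band_cvg :
  symsum (fun n => normc (band_coef n) ^+ 2) m @[m --> \oo] --> t / (2 * pi).
Proof.
have p0 := pi_neq0 R.
have -> : t / (2 * pi) = (0 + pi * t / 2) / pi ^+ 2 by field_pi.
under eq_fun => m.
  rewrite symsum_band_coef.
  have -> : t ^+ 2 / 4 + cos_sum t m = cos_gap t m + pi * t / 2.
    by rewrite /cos_gap; ring.
  over.
apply: cvgM; last exact: cvg_cst.
by apply: cvgD; [exact: cos_gap_cvg0_band|exact: cvg_cst].
Qed.

Lemma band_coef_l2 : band_coef \in @square_summable R.
Proof.
apply/asboolP; rewrite /energy.
by rewrite (esum_symsum_cvg _ symsum_band_cvg) ?ltry// => n; rewrite sqr_ge0.
Qed.

Definition band_response : l2 R := L2 band_coef_l2.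

Lemma is_dft_band_response : is_dft band_response indic.
Proof.
apply/is_dftP; first exact: cbounded_meas_indic.
rewrite /dft_error; under eq_fun do rewrite band_dft_error.
suff : - (2 / pi) * cos_gap t m @[m --> \oo] --> - (2 / pi) * 0 by rewrite mulr0.
by apply: cvgM; [exact: cvg_cst|exact: cos_gap_cvg0_band].
Qed.

(** The chosen response is some square-summable sequence with the prescribed
    transform, hence the explicit one by uniqueness. *)
Lemma ideal_responseE : ideal_response a b = band_response.
Proof.
have h : is_dft (ideal_response a b) indic.
  exact: (@xgetPex _ 0 [set h | is_dft h indic]
    (ex_intro _ band_response is_dft_band_response)).
by apply: dft_unique h is_dft_band_response; exact: cbounded_meas_indic.
Qed.

Lemma l2norm_band : l2norm band_response = Num.sqrt (t / (2 * pi)).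
Proof.
apply: (@l2norm_of_cvg _ band_response _ _ symsum_band_cvg).
by have := t_range; have := pi_gt0 R; move=> ? ?; rewrite divr_ge0//; lra.
Qed.

End Band.

Section Distance.
Local Open Scope complex_scope.
Variable R : realType.
Implicit Types (h g x : l2 R).

Lemma le_l2norm x g : (forall n, normc (x n) <= normc (g n)) ->
  l2norm x <= l2norm g.
Proof.
move=> xg; rewrite /l2norm ler_wsqrtr// fine_le ?energy_fin//.
by apply: le_esum => n _; rewrite lee_fin ler_sqr ?nnegrE ?normc_ge0.
Qed.

Definition past_signal N h : signal R := fun n => if n < - N%:Z then h n else 0.

Lemma past_l2 N h : past_signal N h \in @square_summable R.
Proof.
have /asboolP hfin := l2valP h; apply/asboolP; apply: le_lt_trans hfin.
apply: le_esum => n _; rewrite lee_fin ler_sqr ?nnegrE ?normc_ge0//.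
by rewrite /past_signal; case: ifP => _ //; rewrite normc0 normc_ge0.
Qed.

Definition past N h : l2 R := L2 (past_l2 N h).

(** Removing the part before [- N] leaves a filter of [DF N], and any [g] allowed
    by [DF N] differs from [h] before [- N] by [h] itself; so that part is the
    orthogonal residue. *)
Lemma dist_DF h N : dist (conv_filter h) (DF N) = l2norm (past N h).
Proof.
apply/eqP; rewrite eq_le; apply/andP; split.
  apply: inf_lbound.
    exists 0 => _ [K [_ [g _ ->]] <-].
    by rewrite conv_filterB opnorm_conv_filter l2norm_ge0.
  exists (conv_filter (h - past N h)).
    split; first exact: digital_conv_filter.
    exists (h - past N h) => // n nN.
    transitivity (h n - past_signal N h n); first by [].
    by rewrite /past_signal nN subrr.
  by rewrite conv_filterB opnorm_conv_filter subKr.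
apply: lb_le_inf.
  exists (opnorm (conv_filter h - conv_filter 0)), (conv_filter 0) => //.
  split; first exact: digital_conv_filter.
  by exists 0.
move=> _ [K [_ [g g0 ->]] <-].
rewrite conv_filterB opnorm_conv_filter; apply: le_l2norm => n.
have -> : (h - g) n = h n - g n by [].
rewrite /= /past_signal; case: ifP => [nN|_]; first by rewrite g0// subr0.
by rewrite normc0 normc_ge0.
Qed.

(** The energy before [- N] is half of the energy outside [- N, ..., N], by the
    symmetry of the coefficients in modulus. *)
Lemma l2norm_past_band a b (ab : is_band a b) N :
  l2norm (past N (band_response ab)) =
  Num.sqrt (- cos_gap (b - a) N / (2 * pi ^+ 2)).
Proof.
have p0 := pi_neq0 R.
apply: l2norm_of_cvg.
  apply: divr_ge0; last by rewrite mulr_ge0 ?sqr_ge0.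
  by rewrite oppr_ge0 cos_gap_le0_band.
set u := fun k : int => normc (past N (band_response ab) k) ^+ 2.
have uE n : u n = if n < - N%:Z then normc (band_coef a b n) ^+ 2 else 0.
  by rewrite /u /past /past_signal /=; case: ifP => // _; rewrite normc0 expr0n.
have uN m : (m <= N)%N -> symsum u m = 0.
  move=> mN; rewrite symsumE big_seq big1// => n; rewrite mem_box => nm.
  by rewrite uE ltNge (_ : - N%:Z <= n)//; lia.
have us m : (N <= m)%N ->
    symsum u m = (cos_gap (b - a) m - cos_gap (b - a) N) / (2 * pi ^+ 2).
  elim: m => [|m IH]; first by rewrite leqn0 => /eqP ->; rewrite uN// subrr mul0r.
  rewrite leq_eqVlt => /predU1P[<-|]; first by rewrite uN// subrr mul0r.
  rewrite ltnS => Nm; rewrite symsumS IH// (uE m.+1%:Z) (uE (- m.+1%:Z)).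
  rewrite ifF ?ifT; [|lia|lia].
  rewrite add0r normc_band_coefN normc_band_coef//.
  rewrite /cos_gap /cos_sum big_ord_recr /= -pmulrn.
  by field_pi.
have : (cos_gap (b - a) m - cos_gap (b - a) N) / (2 * pi ^+ 2) @[m --> \oo] -->
    (0 - cos_gap (b - a) N) / (2 * pi ^+ 2).
  apply: cvgM; last exact: cvg_cst.
  by apply: cvgB; [exact: cos_gap_cvg0_band|exact: cvg_cst].
rewrite sub0r; apply: cvg_trans; apply: near_eq_cvg.
by exists N => // m /= Nm; rewrite us.
Qed.

End Distance.

(** * The squared sine of the angle and its limits *)

Section SinSquare.
Variable R : realType.
Implicit Types (t l : R) (N m : nat).

(** The square of the sine of the angle, as a function of the length of the
    band. *)
Definition sin2_angle t N : R := - cos_gap t N / (pi * t).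

Lemma cos_gap_le0 t N : 0 < t < 2 * pi -> cos_gap t N <= 0.
Proof.
(* Every length in (0, 2 pi) is that of a band centred at pi. *)
move=> /andP[t0 t2]; pose a := pi - t / 2; pose b := pi + t / 2.
have ab : is_band a b by split; rewrite /a /b; lra.
have -> : t = b - a by rewrite /a /b; field.
exact: cos_gap_le0_band.
Qed.

Lemma cos_gap_cvg0 t : 0 < t < 2 * pi -> cos_gap t N @[N --> \oo] --> 0.
Proof.
move=> /andP[t0 t2]; pose a := pi - t / 2; pose b := pi + t / 2.
have ab : is_band a b by split; rewrite /a /b; lra.
have -> : t = b - a by rewrite /a /b; field.
exact: cos_gap_cvg0_band.
Qed.

Lemma cos_gapS t N : cos_gap t N.+1 =
  cos_gap t N + (1 - cos (N.+1%:R * t)) / N.+1%:R ^+ 2.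
Proof. by rewrite /cos_gap /cos_sum big_ord_recr /=; ring. Qed.

Lemma cos_gapS_lt t N :
  (cos_gap t N < cos_gap t N.+1) = (cos (N.+1%:R * t) != 1).
Proof.
have c1 := cos_le1 (N.+1%:R * t).
rewrite cos_gapS ltrDl pmulr_lgt0 ?invr_gt0 ?exprn_gt0 ?ltr0n// subr_gt0.
by rewrite lt_neqAle c1 andbT.
Qed.

(** Two consecutive terms cannot both vanish: [cos (k * t) = 1] and
    [cos (k.+1 * t) = 1] would give [cos t = 1]. *)
Lemma cos_gap_lt0 t N : 0 < t < 2 * pi -> cos_gap t N < 0.
Proof.
move=> t02.
have [c1|c1] := eqVneq (cos (N.+1%:R * t)) 1; last first.
  have := cos_gap_le0 N.+1 t02; rewrite -cos_gapS_lt in c1.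
  exact: lt_le_trans.
apply: le_lt_trans (cos_gap_mono t (leqnSn N)) _.
apply: lt_le_trans (cos_gap_le0 N.+2 t02); rewrite cos_gapS_lt.
apply/eqP => c2; have := cos_lt1 t02.
have -> : t = N.+2%:R * t - N.+1%:R * t by rewrite -(natr1 N.+1); ring.
have s1 : sin (N.+1%:R * t) = 0.
  by apply/eqP; rewrite -sqrf_eq0 sin2cos2 c1 expr1n subrr.
by rewrite cosB c1 c2 s1 mulr0 addr0 mulr1 ltxx.
Qed.

Lemma sin2_angle_gt0 t N : 0 < t < 2 * pi -> 0 < sin2_angle t N.
Proof.
move=> t02; have [t0 _] := andP t02.
by rewrite divr_gt0 ?oppr_gt0 ?cos_gap_lt0// mulr_gt0 ?pi_gt0.
Qed.

Lemma sin2_angle_le t N : 0 < t -> sin2_angle t N <= 1 / 2 - t / (4 * pi).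
Proof.
move=> t0; have p0 := pi_gt0 R.
have -> : 1 / 2 - t / (4 * pi) = - (t ^+ 2 / 4 - pi * t / 2) / (pi * t).
  by field_pi; rewrite gt_eqF.
rewrite ler_pM2r ?invr_gt0 ?mulr_gt0// lerN2 /cos_gap -addrA lerDr.
exact: cos_sum_ge0.
Qed.

Lemma sin2_angle_lt t N : 0 < t -> sin2_angle t N < 1 / 2.
Proof.
move=> t0; apply: le_lt_trans (sin2_angle_le N t0) _.
by rewrite ltrBlDr ltrDl divr_gt0// mulr_gt0 ?pi_gt0.
Qed.

(** Near 0 the gap is [- (pi / 2) * t] up to second order, the second derivative
    being a Dirichlet kernel, which is at most [1 / 2 + N]. *)
Lemma sin2_angle_ge t N : 0 < t ->
  1 / 2 - (1 / 2 + N%:R) / pi * t <= sin2_angle t N.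
Proof.
move=> t0; have p0 := pi_gt0 R.
have g0 : cos_gap 0 N = 0 :> R.
  rewrite /cos_gap /cos_sum big1 => [|k _]; last first.
    by rewrite mulr0 cos0 subrr mul0r.
  by rewrite expr0n /=; ring.
have g'0 : cos_gap' 0 N = - pi / 2 :> R.
  rewrite /cos_gap' big1 => [|k _]; last by rewrite mulr0 sin0 mul0r.
  by ring.
have [c [c0 ct]] := MVT_everywhere (fun x => is_derive_cos_gap x N) (ltW t0).
rewrite g0 !subr0 /sin2_angle => ->.
have -> : - (cos_gap' c N * t) / (pi * t) = - cos_gap' c N / pi.
  by field_pi; rewrite gt_eqF.
have [d [d0 dc]] := MVT_everywhere (fun x => is_derive_cos_gap' x N) c0.
rewrite g'0 subr0 => h.
have : dirichlet d N <= 1 / 2 + N%:R.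
  rewrite lerD2l -[X in _ <= X%:R]card_ord -sumr_const; apply: ler_sum => k _.
  exact: cos_le1.
have N0 : 0 <= N%:R :> R by rewrite ler0n.
move=> dN; have dNc : dirichlet d N * c <= (1 / 2 + N%:R) * t.
  by apply: le_trans (ler_wpM2r c0 dN) _; apply: ler_wpM2l => //; lra.
have -> : 1 / 2 - (1 / 2 + N%:R) / pi * t = (pi / 2 - (1 / 2 + N%:R) * t) / pi.
  by field_pi.
rewrite ler_pM2r ?invr_gt0//; lra.
Qed.

Lemma sin2_angleE t N : 0 < t -> sin2_angle t N =
  1 / 2 - t / (4 * pi)
    - \sum_(1 <= k < N.+1) (1 - cos (k%:R * t)) / (k%:R ^+ 2 * pi * t).
Proof.
move=> t0; have t0' : t != 0 by rewrite gt_eqF.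
have -> : \sum_(1 <= k < N.+1) (1 - cos (k%:R * t)) / (k%:R ^+ 2 * pi * t) =
    cos_sum t N / (pi * t).
  rewrite big_add1 big_mkord /cos_sum mulr_suml; apply: eq_bigr => k _.
  by field_pi; rewrite t0'.
by rewrite /sin2_angle /cos_gap; field_pi; rewrite t0'.
Qed.

Lemma sin2_angle_decr t N : 0 < t -> sin2_angle t N.+1 <= sin2_angle t N.
Proof.
move=> t0; rewrite ler_pM2r ?invr_gt0 ?mulr_gt0 ?pi_gt0// lerN2.
exact: cos_gap_mono.
Qed.

Lemma sin2_angle_ltS t N : 0 < t ->
  (sin2_angle t N.+1 < sin2_angle t N) = (cos (N.+1%:R * t) != 1).
Proof.
move=> t0; rewrite ltr_pM2r ?invr_gt0 ?mulr_gt0 ?pi_gt0// ltrN2.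
exact: cos_gapS_lt.
Qed.

Lemma sin2_angle_cvg0 t : 0 < t < 2 * pi ->
  sin2_angle t N @[N --> \oo] --> 0.
Proof.
move=> t02; have : - cos_gap t N / (pi * t) @[N --> \oo] --> - 0 / (pi * t).
  apply: cvgM; last exact: cvg_cst.
  by apply: cvgN; exact: cos_gap_cvg0.
by rewrite oppr0 mul0r.
Qed.

(** Subtracting the largest multiple of [2 * pi] below [t] leaves an angle in
    [[0, 2 * pi[] with cosine 1, which is 0. *)
Lemma cos_eq1P t : 0 <= t -> cos t = 1 <-> exists m : nat, t = m%:R * (2 * pi).
Proof.
move=> t0; have p0 := pi_gt0 R.
split=> [c1|[m ->]]; last exact: (cos_intpi2 R m).
have p20 : 0 < 2 * pi :> R by lra.
exists (Num.trunc (t / (2 * pi))).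
have := truncn_itv (divr_ge0 t0 (ltW p20)).
set m := Num.trunc _; rewrite ler_pdivlMr// ltr_pdivrMr// => /andP[mt tm].
pose r := t - m%:R * (2 * pi).
have cr : cos r = 1.
  rewrite /r cosB (cos_intpi2 R m) (sin_intpi2 R m) c1; ring.
have [r0|r0] := eqVneq r 0; first by move/eqP: r0; rewrite subr_eq0 => /eqP.
have : cos r < 1.
  apply: cos_lt1; rewrite lt_def r0 /r subr_ge0 mt /=.
  by move: tm; rewrite -natr1; lra.
by rewrite cr ltxx.
Qed.

End SinSquare.

Section Asin.
Variable R : realType.

Lemma asin_range (x : R) : 0 <= x <= 1 -> asin x \in `[- (pi / 2), pi / 2].
Proof.
move=> x01; have [|h _] := @asin_def R x; first by lra.
by rewrite in_itv.
Qed.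

Lemma ltr_asin (x y : R) : 0 <= x <= 1 -> 0 <= y <= 1 ->
  (asin x < asin y) = (x < y).
Proof.
move=> hx hy; rewrite -ltr_sin ?asin_range//.
by rewrite !asinK// in_itv /=; lra.
Qed.

Lemma ler_asin (x y : R) : 0 <= x <= 1 -> 0 <= y <= 1 ->
  (asin x <= asin y) = (x <= y).
Proof. by move=> hx hy; rewrite !leNgt ltr_asin. Qed.

Lemma asin_0 : asin 0 = 0 :> R.
Proof.
rewrite -[in LHS](@sin0 R) sinK// in_itv /=.
by have := pi_gt0 R; lra.
Qed.

Lemma asin_sqrt_half : asin (Num.sqrt (1 / 2)) = pi / 4 :> R.
Proof.
have p0 := pi_gt0 R.
have -> : Num.sqrt (1 / 2) = sin (pi / 4) :> R.
  have s0 : 0 <= sin (pi / 4 : R) by apply: sin_ge0_pi; lra.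
  rewrite -[RHS]ger0_norm// -sqrtr_sqr; congr Num.sqrt.
  have : cos (pi / 4 *+ 2 : R) = 0.
    by rewrite -mulr_natr -[RHS](@cos_pihalf R); congr cos; field.
  rewrite cos_mulr2n cos2sin2; lra.
by rewrite sinK// in_itv /=; lra.
Qed.

End Asin.

Section BandLengthLimit.
Variable R : realType.

(** The limit theorems for filters apply to the limits in the length of the
    band through this instance. *)
Global Instance band_length_filter (l : R) : Filter (band_length_nbhs l).
Proof.
apply: within_filter; apply: filter_from_filter; first by exists setT; exact: filterT.
move=> U V lU lV; exists (U `&` V); first exact: filterI.
by move=> ab [].
Qed.

Lemma band_length_cvg (l : R) : ab.2 - ab.1 @[ab --> band_length_nbhs l] --> l.
Proof.
move=> U lU; exists U => //= ab Uab _; exact: Uab.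
Qed.

Lemma near_is_band (l : R) :
  \forall ab \near band_length_nbhs l, is_band ab.1 ab.2.
Proof. by exists setT => //=; exact: filterT. Qed.

Lemma sin2_angle_cvg_0 N :
  sin2_angle (ab.2 - ab.1) N @[ab --> band_length_nbhs (0 : R)] --> (1 / 2 : R).
Proof.
apply: (@squeeze_cvgr _ _ _ _
  (fun ab : R * R => 1 / 2 - (1 / 2 + N%:R) / pi * (ab.2 - ab.1))
  (fun=> 1 / 2)).
- apply: filterS (near_is_band 0) => ab [a0 altb bpi].
  have t0 : 0 < ab.2 - ab.1 by rewrite subr_gt0.
  by rewrite sin2_angle_ge// ltW// sin2_angle_lt.
- rewrite -[X in _ --> X]subr0 -[X in _ --> _ - X](mulr0 ((1 / 2 + N%:R) / pi)).
  apply: cvgB; first exact: cvg_cst.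
  by apply: cvgM; [exact: cvg_cst|exact: band_length_cvg].
- exact: cvg_cst.
Qed.

Lemma sin2_angle_cvg_2pi N :
  sin2_angle (ab.2 - ab.1) N @[ab --> band_length_nbhs (2 * pi : R)] --> (0 : R).
Proof.
apply: (@squeeze_cvgr _ _ _ _ (fun=> 0)
  (fun ab : R * R => 1 / 2 - (ab.2 - ab.1) / (4 * pi))).
- apply: filterS (near_is_band (2 * pi)) => ab [a0 altb bpi].
  have t0 : 0 < ab.2 - ab.1 by rewrite subr_gt0.
  rewrite sin2_angle_le// andbT ltW// sin2_angle_gt0//; lra.
- exact: cvg_cst.
- have -> : 0 = 1 / 2 - 2 * pi / (4 * pi) :> R by field_pi.
  apply: cvgB; first exact: cvg_cst.
  by apply: cvgM; [exact: band_length_cvg|exact: cvg_cst].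
Qed.

End BandLengthLimit.

Section Angle.
Variable R : realType.
Implicit Types a b : R.

Lemma band_length_range a b : is_band a b -> 0 < b - a < 2 * pi.
Proof. by case=> ? ? ?; lra. Qed.

Lemma dist_ideal a b N : is_band a b ->
  dist (ideal_filter a b) (DF N) =
  Num.sqrt ((b - a) / (2 * pi)) * Num.sqrt (sin2_angle (b - a) N).
Proof.
move=> ab; have /andP[t0 _] := band_length_range ab.
rewrite /ideal_filter (ideal_responseE ab) dist_DF l2norm_past_band.
rewrite -sqrtrM; last by rewrite divr_ge0 ?mulr_ge0 ?pi_ge0// ltW.
congr Num.sqrt; rewrite /sin2_angle.
by have := gt_eqF t0; move: (b - a) => t tn0; field_pi; rewrite tn0.
Qed.

Lemma theta_ideal a b N : is_band a b ->
  theta a b N = asin (Num.sqrt (sin2_angle (b - a) N)).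
Proof.
move=> ab; have /andP[t0 _] := band_length_range ab.
rewrite /theta /angle dist_ideal//; congr asin.
rewrite /ideal_filter (ideal_responseE ab) opnorm_conv_filter l2norm_band.
rewrite mulrAC divff ?mul1r// gt_eqF// sqrtr_gt0 divr_gt0// mulr_gt0//.
exact: pi_gt0.
Qed.

Lemma sqrt_sin2_range t N : 0 < t < 2 * pi ->
  0 <= Num.sqrt (sin2_angle t N : R) <= 1.
Proof.
move=> /andP[t0 _]; rewrite sqrtr_ge0 /= -sqrtr1 ler_wsqrtr//.
by have := sin2_angle_lt N t0; lra.
Qed.

Lemma theta_lt a b N M : is_band a b ->
  (theta a b N < theta a b M) =
  (sin2_angle (b - a) N < sin2_angle (b - a) M).
Proof.
move=> ab; have t02 := band_length_range ab; rewrite !theta_ideal//.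
by rewrite ltr_asin ?sqrt_sin2_range// ltr_sqrt// sin2_angle_gt0.
Qed.

Lemma cvg_sqrt (T : Type) (F : set_system T) (FF : Filter F) (f : T -> R) (s : R) :
  f x @[x --> F] --> s -> Num.sqrt (f x) @[x --> F] --> Num.sqrt s.
Proof. by move=> fs; apply: (cvg_comp f Num.sqrt fs); exact: sqrt_continuous. Qed.

Lemma cvg_asin (T : Type) (F : set_system T) (FF : Filter F) (f : T -> R) (s : R) :
  -1 < s < 1 -> f x @[x --> F] --> s -> asin (f x) @[x --> F] --> asin s.
Proof. by move=> s1 fs; apply: (cvg_comp f asin fs); exact: continuous_asin. Qed.

Lemma theta_cvg (l s : R) N : 0 <= s < 1 ->
  sin2_angle (ab.2 - ab.1) N @[ab --> band_length_nbhs l] --> s ->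
  theta ab.1 ab.2 N @[ab --> band_length_nbhs l] --> asin (Num.sqrt s).
Proof.
move=> /andP[s0 s1] cs.
have c : asin (Num.sqrt (sin2_angle (ab.2 - ab.1) N))
    @[ab --> band_length_nbhs l] --> asin (Num.sqrt s).
  apply: cvg_asin; last exact: cvg_sqrt.
  apply/andP; split; first by apply: lt_le_trans (sqrtr_ge0 _); lra.
  by rewrite -[ltRHS]sqrtr1 ltr_sqrt.
apply: cvg_trans c; apply: near_eq_cvg.
by apply: filterS (near_is_band l) => ab hab; rewrite theta_ideal.
Qed.

Lemma dist_cvg (l s : R) N :
  sin2_angle (ab.2 - ab.1) N @[ab --> band_length_nbhs l] --> s ->
  dist (ideal_filter ab.1 ab.2) (DF N) @[ab --> band_length_nbhs l] -->
    Num.sqrt (l / (2 * pi)) * Num.sqrt s.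
Proof.
move=> cs.
have c : Num.sqrt ((ab.2 - ab.1) / (2 * pi)) *
    Num.sqrt (sin2_angle (ab.2 - ab.1) N)
    @[ab --> band_length_nbhs l] --> Num.sqrt (l / (2 * pi)) * Num.sqrt s.
  apply: cvgM; last exact: cvg_sqrt.
  by apply: cvg_sqrt; apply: cvgM; [exact: band_length_cvg|exact: cvg_cst].
apply: cvg_trans c; apply: near_eq_cvg.
by apply: filterS (near_is_band l) => ab hab; rewrite dist_ideal.
Qed.

Lemma theta_ltS a b N : is_band a b ->
  theta a b N.+1 < theta a b N <->
  (forall m : nat, N.+1%:R * (b - a) <> m%:R * (2 * pi)).
Proof.
move=> ab; have /andP[t0 _] := band_length_range ab.
have Nt : 0 <= N.+1%:R * (b - a) by rewrite mulr_ge0// ltW.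
rewrite theta_lt// sin2_angle_ltS//; split.
  by move=> /eqP c1 m Em; apply: c1; apply/(cos_eq1P Nt); exists m.
by move=> h; apply/eqP => /(cos_eq1P Nt)[m /h].
Qed.

End Angle.

(* In (c), theta (N + 1) = theta N exactly when (N + 1)(b - a) is a multiple
   of 2 pi, the (N + 1)-st term of the sum being then 0; so the decrease is
   strict when (b - a) / (2 pi) is irrational. *)
Theorem theorem7 (R : realType) :
  let S (a b : R) (N : nat) : R :=
    1 / 2 - (b - a) / (4 * pi)
    - \sum_(1 <= k < N.+1)
        (1 - cos (k%:R * (b - a))) / (k%:R ^+ 2 * pi * (b - a)) in
  [/\ forall (a b : R) (N : nat), is_band a b ->
        theta a b N = asin (Num.sqrt (S a b N)) /\
        dist (ideal_filter a b) (DF N) =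
          Num.sqrt ((b - a) / (2 * pi)) * Num.sqrt (S a b N),
      forall (a b a' b' : R) (N : nat), is_band a b -> is_band a' b' ->
        b - a = b' - a' ->
        theta a b N = theta a' b' N /\
        dist (ideal_filter a b) (DF N) = dist (ideal_filter a' b') (DF N),
      (* (a) *)
      [/\ forall (a b : R) (N : nat), is_band a b ->
            0 < theta a b N /\ theta a b N < pi / 4,
          forall N : nat,
            theta ab.1 ab.2 N @[ab --> band_length_nbhs (0 : R)] --> (pi / 4 : R) &
          forall N : nat,
            theta ab.1 ab.2 N @[ab --> band_length_nbhs (2 * pi : R)] --> (0 : R)],
      (* (b) *)
      forall N : nat,
        dist (ideal_filter ab.1 ab.2) (DF N)
          @[ab --> band_length_nbhs (0 : R)] --> (0 : R) /\
        dist (ideal_filter ab.1 ab.2) (DF N)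
          @[ab --> band_length_nbhs (2 * pi : R)] --> (0 : R) &
      (* (c) *)
      forall a b : R, is_band a b ->
        [/\ forall N : nat, theta a b N.+1 <= theta a b N,
            forall N : nat, theta a b N.+1 < theta a b N <->
              (forall m : nat, N.+1%:R * (b - a) <> m%:R * (2 * pi)),
            (forall p q : nat, (0 < q)%N -> (b - a) / (2 * pi) <> p%:R / q%:R) ->
              forall N N' : nat, (N < N')%N -> theta a b N' < theta a b N &
            theta a b N @[N --> \oo] --> (0 : R)]].
Proof.
have p0 := pi_gt0 R.
move=> S; split.
- move=> a b N ab; have /andP[t0 _] := band_length_range ab.
  by rewrite /S -sin2_angleE// theta_ideal// dist_ideal.
- move=> a b a' b' N ab ab' E.
  (* Composing the equalities avoids unifying [theta a b N] with [theta a' b' N],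
     which would unfold both. *)
  by split; [apply: (etrans (theta_ideal N ab)); apply: etrans _ (esym (theta_ideal N ab'))
    |apply: (etrans (dist_ideal N ab)); apply: etrans _ (esym (dist_ideal N ab'))];
    rewrite E.
- split=> [a b N ab|N|N].
  + have t02 := band_length_range ab; have /andP[t0 _] := t02.
    have s0 := sin2_angle_gt0 N t02.
    have s01 := sqrt_sin2_range N t02.
    rewrite theta_ideal//; split.
      by rewrite -[ltLHS](@asin_0 R) ltr_asin ?sqrtr_gt0 ?lexx ?ler01.
    rewrite -asin_sqrt_half ltr_asin//; last first.
      by rewrite sqrtr_ge0 /= -[leRHS]sqrtr1 ler_wsqrtr//; lra.
    by rewrite ltr_sqrt ?sin2_angle_lt//; lra.
  + rewrite -asin_sqrt_half; apply: theta_cvg; first by lra.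
    exact: sin2_angle_cvg_0.
  + rewrite -[X in _ --> X](@asin_0 R) -[X in asin X]sqrtr0.
    by apply: theta_cvg; [lra|exact: sin2_angle_cvg_2pi].
- move=> N; split.
  + have := dist_cvg (@sin2_angle_cvg_0 R N).
    by rewrite mul0r sqrtr0 mul0r.
  + have := dist_cvg (@sin2_angle_cvg_2pi R N).
    by rewrite sqrtr0 mulr0.
- move=> a b ab; have t02 := band_length_range ab; have /andP[t0 _] := t02.
  split.
  + move=> N; rewrite !theta_ideal// ler_asin ?sqrt_sin2_range//.
    by rewrite ler_wsqrtr// sin2_angle_decr.
  + by move=> N; exact: theta_ltS.
  + move=> irr N N'; elim: N' => // N' IH.
    have lt1 : theta a b N'.+1 < theta a b N'.
      apply/(theta_ltS _ ab) => m Em; apply: (irr m N'.+1) => //.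
      apply/eqP; rewrite eqr_div ?pnatr_eq0//; first by rewrite mulrC Em.
      by rewrite gt_eqF// mulr_gt0.
    rewrite ltnS leq_eqVlt => /predU1P[->//|/IH].
    exact: lt_trans.
  + have c : asin (Num.sqrt (sin2_angle (b - a) N)) @[N --> \oo] -->
        asin (Num.sqrt (0 : R)).
      apply: cvg_asin; first by rewrite sqrtr0; lra.
      by apply: cvg_sqrt; exact: sin2_angle_cvg0.
    rewrite sqrtr0 asin_0 in c; apply: cvg_trans c; apply: near_eq_cvg.
    by apply: nearW => N; rewrite theta_ideal.
Qed.
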